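(* Assume that $\lim_{p\searrow c} F(p)/(p-c)=\kappa$ for some constant $0<\kappa<\infty$. Let $\varepsilon>0$ (arbitrarily small) and $0<a<\infty$ (arbitrarily large). If $0<b<\infty$ is large enough, then for all large enough $t$, $$P\bigl\{at^{1/2}(\log t)^{-1}\le X_t\le bt^{1/2}\bigr\}\ge 1-\varepsilon.$$ (That is: for all $\varepsilon,a>0$ there is $b_0<\infty$ such that for every $b\ge b_0$ there is $t_0<\infty$ such that the inequality holds for all $t\ge t_0$.)
   Context: Rates: $F$ is a probability distribution function supported on $(c,1]$, where $c>0$ is the left endpoint of the support: $F(p)=0$ for $p<c$, $F(c)=0$, $F(p)>0$ for $p>c$, $F(1)=1$. The rates $\{p_i\}_{i\le 0}$ are i.i.d. with distribution $F$. Process: particles are labeled by nonpositive integers, with positions $\cdots<\xi_{-2}(t)<\xi_{-1}(t)<\xi_0(t)$ in $\mathbf{Z}$ and initial positions $\xi_i(0)=i$ for $i\le 0$. Given the rates, each particle $i$ has an independent Poisson clock of rate $p_i$; whenever it rings, $\xi_i$ moves one step to the right provided the next site to the right is vacant (exclusion rule). $X_t=0\vee\sup\{k\ge 1:\xi_{-k+1}(t)>ct\}$ is the number of particles strictly beyond $ct$ at time $t$. $P$ is the annealed probability measure, under which both the rates and the Poisson clocks are random. *)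

(* Defs.v *)
From HB Require Import structures.
From mathcomp Require Import all_boot all_order all_algebra finmap.
From mathcomp Require Import all_classical all_reals all_analysis.

Set Implicit Arguments.
Unset Strict Implicit.
Unset Printing Implicit Defensive.

Import Order.TTheory GRing.Theory Num.Theory.
Import numFieldNormedType.Exports.

Local Open Scope classical_set_scope.
Local Open Scope ring_scope.

(* The particle with label -k is indexed by k : nat. *)

Section Randomness.
Context d (Omega : measurableType d) (R : realType) (P : probability Omega R).

Definition mutually_independent (X : nat -> {RV P >-> R}) : Prop :=
  forall (J : {fset nat}) (A : nat -> set R),
    (forall k, measurable (A k)) ->
    P (\bigcap_(k in [set` J]) X k @^-1` A k)
      = (\prod_(k <- J) P (X k @^-1` A k))%E.

Definition iid_with_cdf (X : nat -> {RV P >-> R}) (F : R -> R) : Prop :=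
  (forall k x, cdf (X k) x = (F x)%:E) /\ mutually_independent X.

Definition sigma_of (X : nat -> {RV P >-> R}) : set (set Omega) :=
  <<s [set X k @^-1` A | k in [set: nat] & A in measurable] >>.

(* [gap k n] is the waiting time between ring n and ring n + 1 of clock k (with
   ring 0 at time 0).  Conditionally on the sigma-algebra of the rates, all the
   gaps are independent and gap k n is exponential with parameter rate k: this
   is the interarrival-time definition of independent Poisson clocks.
   The integrand is meaningful for positive rates only. *)
Definition poisson_clocks_given (rate : nat -> {RV P >-> R})
    (gap : nat -> nat -> {RV P >-> R}) : Prop :=
  forall (G : set Omega) (J : {fset nat * nat}) (B : nat * nat -> set R),
    sigma_of rate G -> (forall j, measurable (B j)) ->
    P (G `&` \bigcap_(j in [set` J]) gap j.1 j.2 @^-1` B j)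
      = (\int[P]_(w in G)
           \prod_(j <- J) exponential_prob (rate j.1 w) (B j))%E.

End Randomness.

Section Dynamics.
Context (R : realType).
Implicit Types (gap : nat -> nat -> R) (T : nat -> R) (t : R).

(* [ring_time gap k n] is the time of the (n + 1)-st ring of clock k. *)
Definition ring_time gap (k n : nat) : R := \sum_(i < n.+1) gap k i.

(* The number of rings up to time t.  It is well defined when the ring times
   increase to infinity, which is almost surely the case; the default value 0
   is used otherwise. *)
Definition nrings T t : nat :=
  xget 0%N [set n | forall m, (T m <= t) = (m < n)%N].

(* Position after n rings: at each ring the particle attempts a unit step to
   the right, which succeeds iff the target site is not occupied. *)
Fixpoint walk T (occupied : R -> int -> bool) (x0 : int) (n : nat) : int :=
  if n is m.+1 then
    let x := walk T occupied x0 m in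
    if occupied (T m) (x + 1) then x else x + 1
  else x0.

(* Position at time t of the particle labeled -k, started from site -k.  By the
   strict ordering of the particles, the site to the right of particle -(k + 1)
   can only be occupied by particle -k.  Almost surely no two clocks ring
   simultaneously, so that the position of particle -k at a ring time of
   particle -(k + 1) equals its left limit there. *)
Fixpoint xi gap (k : nat) (t : R) : int :=
  let occupied : R -> int -> bool :=
    if k is j.+1 then fun s y => xi gap j s == y else fun _ _ => false in
  walk (ring_time gap k) occupied (- k%:Z) (nrings (ring_time gap k) t).

(* Extended-real valued, since a supremum over a set of integers. *)
Definition num_beyond gap (c t : R) : \bar R :=
  maxe 0%E (ereal_sup [set (k%:R : R)%:E |
    k in [set k : nat | (1 <= k)%N /\ c * t < (xi gap k.-1 t)%:~R]]).

End Dynamics.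

(* Main.v *)
(* Writing D_k(t) = xi_k(t) + k for the number of jumps of particle -k, the process
   is a tandem of queues served at the rates p_0, p_1, ..: particle -k is blocked
   when D_k = D_(k-1).

   Upper bound.  D_k <= D_j <= N_j for all j <= k, where N_j counts the rings of
   clock j.  Among the first b t^(1/2) rates one is likely to be below c + t^(-1/2),
   hence N_j(t) <= c t + O(t^(1/2)) for some j, which b t^(1/2) exceeds.

   Lower bound.  Let k = a t^(1/2) / log t.  All the first k rates are likely to
   exceed c + 2 del with del of order 1 / k.  Feed the tandem with arrivals of rate
   lam = c + del, started from the product of its invariant laws; by Burke's theorem
   the departures from the last queue again form a process of rate lam.  Hence D_k(t)
   is at least lam t - O(t^(1/2)) minus the initial number of customers, whose mean
   is of order sum_j 1 / (p_j - lam) = O(k log k) = O(t^(1/2)), and this beats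
   c t + k since del t is of order t^(1/2) log t.

   Burke's theorem is only used in discrete time, for Bernoulli arrivals and
   services.  Rounding each exponential gap up to a multiple of a small h gives
   i.i.d. geometric gaps, that is, i.i.d. Bernoulli ring slots; the accumulated
   delay is at most one slot per ring, and it is absorbed by reading clock k with a
   lag proportional to k. *)

Require Import Defs.
From HB Require Import structures.
From mathcomp Require Import all_boot all_order all_algebra finmap.
From mathcomp Require Import all_classical all_reals all_analysis.
From mathcomp Require Import measurable_realfun lra ring zify.

Set Implicit Arguments.
Unset Strict Implicit.
Unset Printing Implicit Defensive.

Import Order.TTheory GRing.Theory Num.Theory.
Import numFieldNormedType.Exports.

Local Open Scope classical_set_scope.
Local Open Scope ring_scope.

(** * Burke's theorem in discrete time *)

(** No stationary tandem is built on the probability space. Expectations over Bernoulli slots are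
    finite sums over boolean words, and [Omega] enters only through [prob_all_match], the
    probability, on an event in the rates, that the clocks produce prescribed words. Initial queues
    and arrivals are auxiliary variables, averaged against the services; pathwise, a tandem with
    initial customers sends out at most that many more than the same tandem started empty. Burke's
    theorem appears as an inequality because only initial queues below a finite bound are summed.

    The discrete tandem must stay behind the particles. Rounding delays different clocks by
    different amounts, so it may reverse the order of rings of two neighbours and allow a jump that
    was blocked. The lag per particle is therefore [M] slots, where [M] bounds the number of rings
    of one clock up to time [t]; the mesh depends on [t] and is so small that all lags together take
    at most one unit of time. Counts of rings are controlled by Chebyshev's inequality only, which
    suffices because the surplus [del * t] exceeds [sqrt t] by a factor of order [log t]. *)

Fixpoint words (n : nat) : seq (seq bool) :=
  if n is m.+1 then [seq true :: v | v <- words m] ++ [seq false :: v | v <- words m]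
  else [:: [::]].

Lemma mem_words n v : (v \in words n) = (size v == n).
Proof.
elim: n v => [|n IH] v; first by rewrite inE size_eq0.
rewrite /= mem_cat; case: v => [|b v] /=.
  by apply/negP => /orP[] /mapP[].
have inj c : injective (cons c : seq bool -> seq bool) by move=> x y [].
have neq c : (b == c) = false -> (b :: v) \in [seq c :: u | u <- words n] = false.
  by move=> /eqP bc; apply/negP => /mapP[u _ [/bc]].
by case: b neq => neq; rewrite (mem_map (inj _)) IH eqSS ?(neq true) ?(neq false) ?orbF.
Qed.

Section Expectation.
Context (R : realFieldType).
Implicit Types (al be : R) (n : nat) (f g : seq bool -> R).

Definition word_weight be (v : seq bool) : R := \prod_(b <- v) (if b then be else 1 - be).

Definition word_mean be n f : R := \sum_(v <- words n) word_weight be v * f v.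

Lemma word_mean0 be f : word_mean be 0 f = f [::].
Proof. by rewrite /word_mean big_seq1 /word_weight big_nil mul1r. Qed.

Lemma word_meanS be n f : word_mean be n.+1 f =
  be * word_mean be n (fun v => f (true :: v)) + (1 - be) * word_mean be n (fun v => f (false :: v)).
Proof.
rewrite /word_mean big_cat /= !big_map !mulr_sumr.
by congr (_ + _); apply: eq_bigr => v _; rewrite /word_weight big_cons mulrA.
Qed.

Lemma eq_word_mean be n f g : (forall v, size v = n -> f v = g v) -> word_mean be n f = word_mean be n g.
Proof.
move=> fg; rewrite /word_mean big_seq [RHS]big_seq; apply: eq_bigr => v.
by rewrite mem_words => /eqP/fg ->.
Qed.

Lemma word_meanD be n f g : word_mean be n (fun v => f v + g v) = word_mean be n f + word_mean be n g.
Proof. by rewrite /word_mean -big_split; apply: eq_bigr => v _; rewrite mulrDr. Qed.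

Lemma word_meanZ be n (c : R) f : word_mean be n (fun v => c * f v) = c * word_mean be n f.
Proof. by rewrite /word_mean mulr_sumr; apply: eq_bigr => v _; rewrite mulrCA. Qed.

Lemma word_mean_cst be n (c : R) : word_mean be n (fun=> c) = c.
Proof. by elim: n => [|n IH]; rewrite ?word_mean0 // word_meanS !IH; ring. Qed.

Lemma word_mean_sum be n (I : Type) (r : seq I) (F : I -> seq bool -> R) :
  word_mean be n (fun v => \sum_(i <- r) F i v) = \sum_(i <- r) word_mean be n (F i).
Proof.
rewrite /word_mean exchange_big; apply: eq_bigr => v _.
by rewrite mulr_sumr.
Qed.

Lemma word_mean_drop be m n f : word_mean be (m + n) (fun v => f (drop m v)) = word_mean be n f.
Proof.
elim: m f => [|m IH] f; first by apply: eq_word_mean => v _; rewrite drop0.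
by rewrite addSn word_meanS /= !IH; ring.
Qed.

Lemma word_weight_ge0 be v : 0 <= be <= 1 -> 0 <= word_weight be v.
Proof. by move=> /andP[b0 b1]; apply: prodr_ge0 => -[] _ //; rewrite subr_ge0. Qed.

Lemma le_word_mean be n f g : 0 <= be <= 1 -> (forall v, size v = n -> f v <= g v) ->
  word_mean be n f <= word_mean be n g.
Proof.
move=> be01 fg; rewrite /word_mean big_seq [leRHS]big_seq; apply: ler_sum => v.
by rewrite mem_words => /eqP/fg vfg; rewrite ler_wpM2l // word_weight_ge0.
Qed.

Lemma word_mean_ge0 be n f : 0 <= be <= 1 -> (forall v, 0 <= f v) -> 0 <= word_mean be n f.
Proof. by move=> be01 f0; rewrite -(word_mean_cst be n 0); apply: le_word_mean. Qed.

(** The second moment is taken about an arbitrary point [x] so that the induction closes: a first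
    letter [true] only shifts [x] by one. *)
Lemma word_mean_count_sqr be n (x : R) :
  word_mean be n (fun v => ((count id v)%:R - x) ^+ 2) =
  (n%:R * be - x) ^+ 2 + n%:R * be * (1 - be).
Proof.
elim: n x => [|n IH] x; first by rewrite word_mean0 /=; ring.
rewrite word_meanS (@eq_word_mean _ _ (fun v => ((count id (true :: v))%:R - x) ^+ 2)
  (fun v => ((count id v)%:R - (x - 1)) ^+ 2)); last first.
  by move=> v _; rewrite /= natrD; congr (_ ^+ 2); ring.
by rewrite !IH -[n.+1%:R]natr1; ring.
Qed.

(** Chebyshev's inequality, with the variance [n * be * (1 - be)] bounded by the mean. *)
Lemma word_mean_count_ge be n (y : nat) : 0 <= be <= 1 -> n%:R * be < y%:R ->
  word_mean be n (fun v => (y <= count id v)%N%:R) <= n%:R * be / (y%:R - n%:R * be) ^+ 2.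
Proof.
move=> be01 ylt; have d0 : 0 < y%:R - n%:R * be by rewrite subr_gt0.
rewrite ler_pdivlMr ?exprn_gt0 // mulrC -word_meanZ.
apply: (@le_trans _ _ (word_mean be n (fun v => ((count id v)%:R - n%:R * be) ^+ 2))).
  apply: le_word_mean => // v _; case: leqP => [yc|_]; last by rewrite mulr0 sqr_ge0.
  rewrite mulr1 lerXn2r ?nnegrE ?subr_ge0 ?(ltW ylt) //.
    by rewrite (le_trans (ltW ylt)) // ler_nat.
  by rewrite lerB // ler_nat.
rewrite word_mean_count_sqr subrr expr0n add0r; case/andP: be01 => b0 b1.
by rewrite ler_piMr ?mulr_ge0 // ?ler_wnDr //; lra.
Qed.

Lemma word_mean_count_lt be n (y : R) : 0 <= be <= 1 -> y < n%:R * be ->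
  word_mean be n (fun v => ((count id v)%:R < y)%R%:R) <= n%:R * be / (n%:R * be - y) ^+ 2.
Proof.
move=> be01 ylt; have d0 : 0 < n%:R * be - y by rewrite subr_gt0.
rewrite ler_pdivlMr ?exprn_gt0 // mulrC -word_meanZ.
apply: (@le_trans _ _ (word_mean be n (fun v => ((count id v)%:R - n%:R * be) ^+ 2))).
  apply: le_word_mean => // v _; case: ltP => [yc|_]; last by rewrite mulr0 sqr_ge0.
  rewrite mulr1 -[leRHS]sqrrN opprB lerXn2r ?nnegrE ?subr_ge0 ?(ltW ylt) //.
    by rewrite (le_trans (ltW yc)) // ltW.
  by rewrite lerB // ltW.
rewrite word_mean_count_sqr subrr expr0n add0r; case/andP: be01 => b0 b1.
by rewrite ler_piMr ?mulr_ge0 //; lra.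
Qed.

End Expectation.

Section Burke.
Context (R : realFieldType).
Implicit Types (al be : R) (n : nat).

(* Parallel update: a customer arriving in a slot is not served in that slot. *)
Fixpoint departures (q : nat) (a b : seq bool) : seq bool :=
  match a, b with
  | a1 :: a', b1 :: b' =>
      let d := b1 && (0 < q)%N in d :: departures (q + a1 - d) a' b'
  | _, _ => [::]
  end.

Definition queue_ratio al be : R := al * (1 - be) / (be * (1 - al)).

(** Stationary law of the queue length: [al / be] is the probability of a nonempty queue, and given
    that, the length is geometric. Zero is exceptional since a service in an empty queue is lost. *)
Definition queue_law al be (q : nat) : R :=
  if q is q'.+1 then al / be * (1 - queue_ratio al be) * queue_ratio al be ^+ q'
  else 1 - al / be.

Section Single.
Context (al be : R) (al_gt0 : 0 < al) (al_be : al < be) (be_lt1 : be < 1).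

Local Notation r := (queue_ratio al be).
Local Notation pi := (queue_law al be).

Let be_gt0 : 0 < be. Proof. exact: lt_trans al_be. Qed.
Let al_lt1 : al < 1. Proof. exact: lt_trans be_lt1. Qed.
Let al1_gt0 : 0 < 1 - al. Proof. by rewrite subr_gt0. Qed.
Let be1_gt0 : 0 < 1 - be. Proof. by rewrite subr_gt0. Qed.
Let be_neq0 : be != 0. Proof. by rewrite gt_eqF. Qed.
Let al1_neq0 : 1 - al != 0. Proof. by rewrite gt_eqF. Qed.
Let al01 : 0 <= al <= 1. Proof. by rewrite !ltW. Qed.
Let be01 : 0 <= be <= 1. Proof. by rewrite !ltW. Qed.

Lemma queue_ratio_ge0 : 0 <= r.
Proof. by rewrite divr_ge0 ?mulr_ge0 ?ltW. Qed.

Lemma queue_ratio_lt1 : r < 1.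
Proof.
rewrite /queue_ratio ltr_pdivrMr ?mulr_gt0 // mul1r -subr_gt0.
have -> : be * (1 - al) - al * (1 - be) = be - al by ring.
by rewrite subr_gt0.
Qed.

Lemma queue_law_ge0 q : 0 <= pi q.
Proof.
case: q => [|q] /=; first by rewrite subr_ge0 ler_pdivrMr // mul1r ltW.
by rewrite !mulr_ge0 ?exprn_ge0 ?queue_ratio_ge0 ?subr_ge0 ?(ltW queue_ratio_lt1) ?invr_ge0 ?ltW.
Qed.

Lemma sum_queue_law L : \sum_(q < L.+1) pi q = 1 - al / be * r ^+ L.
Proof.
elim: L => [|L IH]; first by rewrite big_ord1 expr0 mulr1.
by rewrite big_ord_recr /= IH exprS; ring.
Qed.

Lemma sum_queue_law_le1 L : \sum_(q < L) pi q <= 1.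
Proof.
case: L => [|L]; first by rewrite big_ord0.
by rewrite sum_queue_law gerBl mulr_ge0 ?exprn_ge0 ?queue_ratio_ge0 // divr_ge0 ?ltW.
Qed.

Lemma mean_queue_law L : \sum_(q < L) pi q * q%:R <= al * (1 - al) / (be - al).
Proof.
have r1 : 0 < 1 - r by rewrite subr_gt0 queue_ratio_lt1.
have bd0 : 0 < be - al by rewrite subr_gt0.
have m0 : 0 < al * (1 - al) / (be - al) by rewrite divr_gt0 ?mulr_gt0.
case: L => [|L]; first by rewrite big_ord0 ltW.
(* The subtracted term is the part of the mean carried by lengths above [L]. *)
have -> : \sum_(q < L.+1) pi q * q%:R =
    al * (1 - al) / (be - al) - al / be * r ^+ L * (L%:R + (1 - r)^-1).
  have er : 1 - r = (be - al) / (be * (1 - al)) by rewrite /queue_ratio; field; apply/andP.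
  elim: L => [|L IH].
    by rewrite big_ord1 mulr0 expr0 er; field; rewrite al1_neq0 be_neq0 gt_eqF.
  rewrite big_ord_recr /= IH -natr1 exprS; move: r1; set r' := queue_ratio _ _ => r1.
  by field; rewrite be_neq0 !gt_eqF.
rewrite gerBl mulr_ge0 //; last by rewrite addr_ge0 // invr_ge0 ltW.
by rewrite mulr_ge0 ?exprn_ge0 ?queue_ratio_ge0 // divr_ge0 ?ltW.
Qed.

(** Detailed balance between the lengths [q] and [q.+1]. A queue grows by an arrival without a
    service; at length zero no service takes effect, so the factor [1 - be] is absent. *)
Lemma queue_law_balance q :
  be * (1 - al) * pi q.+1 = (if q is 0%N then al else al * (1 - be)) * pi q.
Proof.
case: q => [|q] /=; last by rewrite exprS /queue_ratio; field; rewrite al1_neq0 be_neq0.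
by rewrite expr0 /queue_ratio; field; rewrite al1_neq0 be_neq0.
Qed.

(* The queue left behind and the departure are independent, with laws
   [queue_law] and Bernoulli([al]).  The term in [L.+1] is the flow that is lost
   by restricting to initial queues of length at most [L]. *)
Lemma queue_law_step (G : nat -> bool -> R) L :
  \sum_(q < L.+1) pi q *
    (al * (be * G (q + 1 - (0 < q))%N (0 < q)%N + (1 - be) * G (q + 1)%N false)
     + (1 - al) * (be * G (q - (0 < q))%N (0 < q)%N + (1 - be) * G q false))
  + pi L.+1 * (be * (1 - al) * G L true + al * G L.+1 true
               + (1 - al) * (1 - be) * G L.+1 false)
  = \sum_(q < L.+2) pi q * (al * G q true + (1 - al) * G q false).
Proof.
elim: L => [|L IH].
  rewrite !big_ord_recr !big_ord0 /= !add0n.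
  have := queue_law_balance 0; rewrite /= => e.
  set p1 := _ * _ ^+ 0 in e *; set p0 := 1 - al / be in e *.
  set x := G 0%N true; set y := G 0%N false; set z := G 1%N true; set w := G 1%N false.
  have e' : al * p0 = be * (1 - al) * p1 by [].
  transitivity (be * (1 - al) * p1 * x + al * p0 * w + (1 - al) * p0 * y + p1 * al * z
     + p1 * (1 - al) * (1 - be) * w); first by ring.
  rewrite -e'; transitivity (al * p0 * x + (al * p0) * w + (1 - al) * p0 * y + p1 * al * z
     + (p1 * (1 - al) - be * (1 - al) * p1) * w); first by ring.
  by rewrite -e'; ring.
rewrite big_ord_recr [RHS]big_ord_recr -IH /= subn1 addn1 subSS subn0.
have := queue_law_balance L.+1; rewrite /= => e.
set p1 := _ * _ ^+ L in e *; set p2 := _ * _ ^+ L.+1 in e *.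
set S := \sum_(_ < _) _.
set x := G L.+1 true; set y := G L.+1 false; set z := G L.+2 true; set w := G L.+2 false.
set u := G L true.
have e' : (1 - be) * al * p1 = be * (1 - al) * p2 by rewrite e; ring.
transitivity (S + p1 * (al * be * x + (1 - al) * be * u + (1 - al) * (1 - be) * y)
   + (1 - be) * al * p1 * w + be * (1 - al) * p2 * x
   + p2 * (al * z + (1 - al) * (1 - be) * w)); first by ring.
transitivity (S + p1 * (al * be * x + (1 - al) * be * u + (1 - al) * (1 - be) * y)
   + be * (1 - al) * p2 * w + (1 - be) * al * p1 * x
   + p2 * (al * z + (1 - al) * (1 - be) * w)); first by rewrite e'.
by ring.
Qed.

(** By [queue_law_step], the first departure is Bernoulli and independent of the queue left behind,
    which again has the law [queue_law]; the remaining slots are handled by induction. Each slot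
    raises the truncation by one, and the nonnegative lost flow is dropped. *)
Lemma burke n f L : (forall v, 0 <= f v) ->
  \sum_(q < L) pi q * word_mean al n (fun a => word_mean be n (fun b => f (departures q a b)))
  <= word_mean al n f.
Proof.
elim: n f L => [|n IH] f L f0.
  rewrite word_mean0; under eq_bigr do rewrite !word_mean0 /=.
  by rewrite -mulr_suml ler_piMl // sum_queue_law_le1.
case: L => [|L]; first by rewrite big_ord0 word_mean_ge0.
(* The mean of [f] over the later slots, once the first slot has shown the departure [d] and left a
   queue of length [q]. *)
pose G q (d : bool) := word_mean al n (fun a => word_mean be n (fun b => f (d :: departures q a b))).
have G0 q d : 0 <= G q d by rewrite /G; apply: word_mean_ge0 => // a; exact: word_mean_ge0.
have := queue_law_step G L.
set S := \sum_(_ < L.+1) _; set rest := queue_law _ _ _ * _ => eqS.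
have rest0 : 0 <= rest.
  by rewrite /rest mulr_ge0 ?queue_law_ge0 // !addr_ge0 // !mulr_ge0 // ltW.
have -> : \sum_(q < L.+1) pi q * word_mean al n.+1 (fun a => word_mean be n.+1 (fun b => f (departures q a b))) = S.
  apply: eq_bigr => q _; congr (_ * _); rewrite word_meanS.
  under eq_word_mean do rewrite word_meanS /=.
  under [X in _ + _ * X]eq_word_mean do rewrite word_meanS /=.
  by rewrite !word_meanD !word_meanZ !addn0 !subn0.
rewrite word_meanS (@le_trans _ _ (S + rest)) ?lerDl // eqS.
under eq_bigr do rewrite mulrDr.
rewrite big_split lerD //=.
  under eq_bigr do rewrite mulrCA.
  by rewrite -mulr_sumr ler_wpM2l ?(ltW al_gt0) // (IH (fun v => f (true :: v))).
under eq_bigr do rewrite mulrCA.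
by rewrite -mulr_sumr ler_wpM2l ?(ltW al1_gt0) // (IH (fun v => f (false :: v))).
Qed.

End Single.
End Burke.

(** * Pathwise comparison of queues and tandems *)

Lemma count_takeS (v : seq bool) j :
  count id (take j.+1 v) = (count id (take j v) + nth false v j)%N.
Proof.
elim: v j => [|b v IH] j /=; first by rewrite nth_nil.
by case: j => [|j] /=; rewrite ?take0 ?addn0 // IH addnA.
Qed.

Lemma size_departures q a b : size a = size b -> size (departures q a b) = size b.
Proof. by elim: a b q => [|x a IH] [|y b] q //= [/IH ->]. Qed.

(** Eliminates the queue length: at slot [j] it is [q] plus the arrivals minus the departures of the
    earlier slots. *)
Lemma nth_departures q a b j : size a = size b -> (j < size b)%N ->
  nth false (departures q a b) j =
  nth false b j && (count id (take j (departures q a b)) < q + count id (take j a))%N.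
Proof.
elim: a b q j => [|x a IH] [|y b] q [|j] //= [sab]; first by rewrite addn0.
by rewrite ltnS => jb; rewrite IH //; congr (_ && _); case: y => /=; lia.
Qed.

Lemma departures_le_service q a b j : size a = size b -> (j <= size b)%N ->
  (count id (take j (departures q a b)) <= count id (take j b))%N.
Proof.
move=> sab; elim: j => [|j IH] jb; first by rewrite !take0.
rewrite !count_takeS nth_departures //; have := IH (ltnW jb); case: (nth false b j) => /=; lia.
Qed.

Lemma departures_le_arrival a b j : size a = size b -> (j <= size b)%N ->
  (count id (take j (departures 0 a b)) <= count id (take j a))%N.
Proof.
move=> sab; elim: j => [|j IH] jb; first by rewrite !take0.
rewrite !count_takeS nth_departures //; have := IH (ltnW jb); case: (nth false b j) => /=; lia.
Qed.

(** The excess can grow only in a slot whose service is used by the first queue and not by the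
    second. The second is then empty, so its departures equal its arrivals, while the departures of
    the first stay within its arrivals plus [q]. *)
Lemma departures_compare a a' b q S j : size a = size b -> size a' = size b ->
  (forall i, (i <= size b)%N -> (count id (take i a) <= count id (take i a') + S)%N) ->
  (j <= size b)%N ->
  (count id (take j (departures q a b)) <= count id (take j (departures 0 a' b)) + (S + q))%N.
Proof.
move=> sab sa'b aa'; elim: j => [|j IH] jb; first by rewrite !take0.
rewrite !count_takeS !nth_departures //; have := IH (ltnW jb); have := aa' j (ltnW jb).
by case: (nth false b j) => /=; lia.
Qed.

Fixpoint tandem_run (a : seq bool) (qs : seq nat) (bs : seq (seq bool)) : seq bool :=
  match qs, bs with
  | q :: qs', b :: bs' => tandem_run (departures q a b) qs' bs'
  | _, _ => a
  end.

(* The first particle is never blocked: [b] is its sequence of departures. *)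
Definition empty_tandem (b : seq bool) (bs : seq (seq bool)) : seq bool :=
  foldl (departures 0) b bs.

(** Each queue hands on the excess of its arrivals, enlarged by its own initial customers. *)
Lemma tandem_run_compare n a a' qs bs S : size qs = size bs ->
  size a = n -> size a' = n -> (forall b, b \in bs -> size b = n) ->
  (forall i, (i <= n)%N -> (count id (take i a) <= count id (take i a') + S)%N) ->
  (count id (tandem_run a qs bs) <= count id (empty_tandem a' bs) + (S + sumn qs))%N.
Proof.
elim: bs qs a a' S => [|b bs IH] [|q qs] // a a' S /= sq sa sa' sb aa'.
  by have := aa' n (leqnn n); rewrite -{1}sa -{1}sa' !take_size addn0.
case: sq => sq; have sbn : size b = n by apply: sb; rewrite inE eqxx.
rewrite [(S + (_ + _))%N]addnA; apply: IH => //; try by rewrite size_departures sbn.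
  by move=> b' b'bs; apply: sb; rewrite inE b'bs orbT.
by move=> i ilen; apply: departures_compare; rewrite ?sbn.
Qed.

(** * Tandems started from truncated stationary laws *)

Section Tandem.
Context (R : realType).
Implicit Types (al be : R) (n L : nat) (bes : seq R).

(** Each word has its own length: in the application the clock of index [k] runs over [k * M + n]
    slots. *)
Fixpoint words_mean (l : seq (nat * R)) (f : seq (seq bool) -> R) : R :=
  if l is (n, be) :: l' then word_mean be n (fun v => words_mean l' (fun vs => f (v :: vs)))
  else f [::].

(* The initial queue lengths are truncated below [L], which keeps the sums
   finite; [L] tends to infinity in [empty_tandem_tail]. *)
Fixpoint tandem_mean al L n bes (F : seq nat -> seq (seq bool) -> R) : R :=
  if bes is be :: bes' then
    \sum_(q < L) queue_law al be q *
      word_mean be n (fun b => tandem_mean al L n bes' (fun qs bs => F (val q :: qs) (b :: bs)))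
  else F [::] [::].

Definition fits n m (qs : seq nat) (bs : seq (seq bool)) :=
  [/\ size qs = m, size bs = m & forall b, b \in bs -> size b = n].

Definition mass al L bes : R := \prod_(be <- bes) \sum_(q < L) queue_law al be q.

Section TandemMean.
Context al L n (al_gt0 : 0 < al).
Let ok bes := forall be, be \in bes -> al < be < 1.

Let ok_cons be bes : ok (be :: bes) -> [/\ al < be, be < 1, 0 <= be <= 1 & ok bes].
Proof.
move=> H; have /andP[h1 h2] := H be (mem_head _ _); split=> //.
  by rewrite (ltW h2) (ltW (lt_trans al_gt0 h1)).
by move=> b bb; apply: H; rewrite inE bb orbT.
Qed.

Lemma tandem_meanD bes F G : tandem_mean al L n bes (fun qs bs => F qs bs + G qs bs) =
  tandem_mean al L n bes F + tandem_mean al L n bes G.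
Proof.
elim: bes F G => //= be bes IH F G; rewrite -big_split; apply: eq_bigr => q _ /=.
rewrite -mulrDr -word_meanD; congr (_ * _); apply: eq_word_mean => v _.
by rewrite IH.
Qed.

Lemma tandem_meanZ bes c F : tandem_mean al L n bes (fun qs bs => c * F qs bs) = c * tandem_mean al L n bes F.
Proof.
elim: bes F => //= be bes IH F; rewrite mulr_sumr; apply: eq_bigr => q _ /=.
rewrite mulrCA -(word_meanZ _ _ c); congr (_ * _); apply: eq_word_mean => v _.
by rewrite IH.
Qed.

Lemma le_tandem_mean bes F G : ok bes -> (forall qs bs, fits n (size bes) qs bs -> F qs bs <= G qs bs) ->
  tandem_mean al L n bes F <= tandem_mean al L n bes G.
Proof.
elim: bes F G => [|be bes IH] F G /=; first by move=> _; apply.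
move=> /ok_cons[h1 h2 h3 h4] FG; apply: ler_sum => q _.
rewrite ler_wpM2l ?queue_law_ge0 //; apply: le_word_mean => // v sv; apply: IH => // qs bs [s1 s2 s3].
apply: FG; split=> /=; rewrite ?s1 ?s2 //.
by move=> b; rewrite inE => /orP[/eqP->//|]; exact: s3.
Qed.

Lemma tandem_mean_services bes (g : seq (seq bool) -> R) :
  tandem_mean al L n bes (fun _ => g) = mass al L bes * words_mean [seq (n, be) | be <- bes] g.
Proof.
elim: bes g => [|be bes IH] g /=; first by rewrite /mass big_nil mul1r.
rewrite /mass big_cons -mulrA mulr_suml; apply: eq_bigr => q _; congr (_ * _).
by rewrite -word_meanZ; apply: eq_word_mean => v _; rewrite IH.
Qed.

Lemma mass_ge0 bes : ok bes -> 0 <= mass al L bes.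
Proof.
elim: bes => [|be bes IH]; first by rewrite /mass big_nil.
move=> /ok_cons[h1 h2 h3 h4]; rewrite /mass big_cons mulr_ge0 ?IH //.
by apply: sumr_ge0 => q _; exact: queue_law_ge0.
Qed.

Lemma mass_le1 bes : ok bes -> mass al L bes <= 1.
Proof.
elim: bes => [|be bes IH]; first by rewrite /mass big_nil.
move=> /ok_cons[h1 h2 h3 h4]; rewrite /mass big_cons mulr_ile1 ?IH ?sum_queue_law_le1 //.
  by apply: sumr_ge0 => q _; exact: queue_law_ge0.
exact: mass_ge0.
Qed.

Lemma words_mean_cst l (c : R) : words_mean l (fun=> c) = c.
Proof.
by elim: l => //= -[m be] l IH; rewrite -[RHS](word_mean_cst be m); apply: eq_word_mean => v _.
Qed.

Lemma tandem_mean_sumn bes : ok bes ->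
  tandem_mean al L n bes (fun qs _ => (sumn qs)%:R) <= \sum_(be <- bes) al * (1 - al) / (be - al).
Proof.
elim: bes => [|be bes IH] /=; first by rewrite big_nil.
move=> /ok_cons[h1 h2 h3 h4]; rewrite big_cons.
have M0 b : al < b < 1 -> 0 <= al * (1 - al) / (b - al).
  move=> /andP[ab b1]; rewrite divr_ge0 ?subr_ge0 ?(ltW ab) // mulr_ge0 ?(ltW al_gt0) //.
  by rewrite subr_ge0 (ltW (lt_trans ab b1)).
apply: (@le_trans _ _ (\sum_(q < L) (queue_law al be q * q%:R + queue_law al be q *
    \sum_(be <- bes) al * (1 - al) / (be - al)))).
  apply: ler_sum => q _; rewrite -mulrDr ler_wpM2l ?queue_law_ge0 //.
  rewrite -[leRHS](word_mean_cst be n); apply: le_word_mean => // v _.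
  have -> : tandem_mean al L n bes (fun qs bs => (val q + sumn qs)%:R) =
     tandem_mean al L n bes (fun _ _ => q%:R) + tandem_mean al L n bes (fun qs _ => (sumn qs)%:R).
    by rewrite -tandem_meanD; congr (tandem_mean _ _ _ _ _); apply/funext => qs; apply/funext => bs; rewrite natrD.
  rewrite lerD ?IH // (tandem_mean_services bes (fun=> q%:R)) words_mean_cst.
  by rewrite ler_piMl // mass_le1.
rewrite big_split lerD //= ?mean_queue_law // -mulr_suml ler_piMl ?sum_queue_law_le1 //.
by rewrite big_seq sumr_ge0 // => b /h4; exact: M0.
Qed.

(** The output of the first queue is again a Bernoulli word of parameter [al], so [burke] removes
    the queues one at a time; the rest of the tandem enters only through a nonnegative function [g]
    of that output. *)
Lemma burke_tandem bes f : ok bes -> (forall v, 0 <= f v) ->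
  word_mean al n (fun a => tandem_mean al L n bes (fun qs bs => f (tandem_run a qs bs))) <= word_mean al n f.
Proof.
elim: bes f => [|be bes IH] f //= /ok_cons[h1 h2 h3 h4] f0.
pose g w := tandem_mean al L n bes (fun qs bs => f (tandem_run w qs bs)).
have g0 w : 0 <= g w.
  rewrite /g; have <- : tandem_mean al L n bes (fun _ _ => 0) = 0.
    by rewrite (tandem_mean_services bes (fun=> 0)) words_mean_cst mulr0.
  exact: le_tandem_mean.
rewrite word_mean_sum; under eq_bigr do rewrite word_meanZ.
apply: le_trans (IH f h4 f0).
exact: (@burke _ _ _ al_gt0 h1 h2 n g).
Qed.

End TandemMean.

Lemma cvg_mass al bes : 0 < al -> (forall be, be \in bes -> al < be < 1) ->
  mass al L.+1 bes @[L --> \oo] --> (1 : R).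
Proof.
move=> al0; elim: bes => [|be bes IH] H.
  rewrite (_ : (fun L => mass al L.+1 [::]) = fun=> 1); first exact: cvg_cst.
  by apply/funext => L; rewrite /mass big_nil.
have /andP[h1 h2] := H be (mem_head _ _).
rewrite (_ : (fun L => mass al L.+1 (be :: bes)) =
    (fun L => (1 - al / be * queue_ratio al be ^+ L) * mass al L.+1 bes)); last first.
  by apply/funext => L; rewrite /mass big_cons (@sum_queue_law R al be).
rewrite -[X in _ --> X]mulr1; apply: cvgM; last first.
  by apply: IH => b bb; apply: H; rewrite inE bb orbT.
rewrite -[X in _ --> X]subr0; apply: cvgB; first exact: cvg_cst.
rewrite (_ : 0 = al / be * 0); last by rewrite mulr0.
apply: cvgMr; apply: cvg_expr.
by rewrite ger0_norm ?queue_ratio_lt1 ?queue_ratio_ge0.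
Qed.

(** If the empty tandem lets out fewer than [x] customers, the stationary one lets out fewer than
    [x + y] or holds at least [y] customers at the start. Burke's theorem makes the output of the
    latter Bernoulli of parameter [al], and Markov's inequality bounds the initial number. *)
Lemma empty_tandem_tail al be0 bes n (x y : R) : 0 < al -> 0 < y ->
  (forall be, be \in be0 :: bes -> al < be < 1) ->
  words_mean [seq (n, be) | be <- be0 :: bes]
     (fun bs => ((count id (empty_tandem (head [::] bs) (behead bs)))%:R < x)%R%:R)
  <= word_mean al n (fun a => ((count id a)%:R < x + y)%R%:R)
     + (\sum_(be <- be0 :: bes) al * (1 - al) / (be - al)) / y.
Proof.
move=> al0 y0 ok.
set e := words_mean _ _; set B := _ + _ / _.
have /andP[h1 h2] := ok be0 (mem_head _ _).
have al01 : 0 <= al <= 1 by rewrite (ltW al0) (ltW (lt_trans h1 h2)).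
have key L : mass al L (be0 :: bes) * e <= B.
  rewrite -tandem_mean_services.
  rewrite -(word_mean_cst al n (tandem_mean _ _ _ _ _)).
  apply: (@le_trans _ _ (word_mean al n (fun a => tandem_mean al L n (be0 :: bes) (fun qs bs =>
     ((count id (tandem_run a qs bs))%:R < x + y)%R%:R + y^-1 * (sumn qs)%:R)))).
    apply: le_word_mean => // a sa; apply: le_tandem_mean => // -[|q qs] [|b bs] [//= [s1] [s2] s3].
    have sb : size b = n by apply: s3; rewrite inE eqxx.
    have cmp : (count id (tandem_run (departures q a b) qs bs) <=
       count id (empty_tandem b bs) + (q + sumn qs))%N.
      apply: (@tandem_run_compare n) => //; rewrite ?s1 ?s2 ?size_departures ?sa ?sb //.
        by move=> b' b'bs; apply: s3; rewrite inE b'bs orbT.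
      (* The departures of the first queue are bounded by its services [b], which are the jumps of
         the unblocked first particle. *)
      by move=> i ilen; rewrite (leq_trans (departures_le_service _ _ _)) ?sa ?sb ?leq_addr.
    case: ltP => [ltx|_]; last by rewrite addr_ge0 // mulr_ge0 // invr_ge0 ltW.
    case: ltP => [_|gexy]; first by rewrite lerDl mulr_ge0 // invr_ge0 ltW.
    rewrite add0r ler_pdivlMl // mulr1.
    have : ((count id (tandem_run (departures q a b) qs bs))%:R : R) <=
       (count id (empty_tandem b bs))%:R + (q + sumn qs)%:R by rewrite -natrD ler_nat.
    by move: gexy ltx => /=; lra.
  under eq_word_mean do rewrite tandem_meanD tandem_meanZ; rewrite word_meanD lerD //.
    by apply: (@burke_tandem al L n al0 (be0 :: bes) (fun v => ((count id v)%:R < x + y)%R%:R)).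
  by rewrite word_mean_cst mulrC ler_wpM2r ?invr_ge0 ?(ltW y0) // tandem_mean_sumn.
(* The bound [B] is uniform in [L], and the mass of the truncated laws tends to one. *)
have := cvg_mass al0 ok => cm.
have cme : mass al L.+1 (be0 :: bes) * e @[L --> \oo] --> 1 * e.
  by apply: cvgM => //; exact: cvg_cst.
rewrite -[e]mul1r -(cvg_lim (@Rhausdorff _) cme).
apply: limr_le; first by apply/cvg_ex; exists (1 * e).
by near=> L; exact: key.
Unshelve. all: by end_near. Qed.

End Tandem.

(** * Paths and their discretization *)

Section Matching.
Context (R : realType) (h : R) (h_gt0 : 0 < h).
Implicit Types (g : nat -> R) (v : seq bool) (i J m n : nat).

(* The constraints on successive gaps expressing that [v] lists the slots that
   contain a ring, every gap being rounded up to a multiple of [h]; [i] slots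
   have elapsed since the last ring. *)
Fixpoint gap_slots i v : seq (set R) :=
  match v with
  | [::] => [:: [set x | i%:R * h < x]]
  | true :: v' => [set x | i%:R * h < x <= i.+1%:R * h] :: gap_slots 0 v'
  | false :: v' => gap_slots i.+1 v'
  end.

(** The default [setT] leaves the gaps after the last listed one free. *)
Definition matches i g v := forall l, nth setT (gap_slots i v) l (g l).

Lemma size_gap_slots i v : size (gap_slots i v) = (count id v).+1.
Proof. by elim: v i => //= -[] v IH i /=; rewrite IH. Qed.

Lemma matches_true i g v : matches i g (true :: v) ->
  i%:R * h < g 0%N <= i.+1%:R * h /\ matches 0 (fun l => g l.+1) v.
Proof. by move=> H; split; [exact: (H 0%N)|move=> l; exact: (H l.+1)]. Qed.

Lemma matches_head i g v : matches i g v -> i%:R * h < g 0%N.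
Proof.
elim: v i => [|[] v IH] i; first by move/(_ 0%N).
  by move=> /matches_true[/andP[]].
move=> /(IH i.+1); apply: le_lt_trans.
by rewrite ler_wpM2r ?(ltW h_gt0) // ler_nat.
Qed.

Lemma exists_matches n i g : (forall l, 0 < g l) -> i%:R * h < g 0%N ->
  exists2 v, size v = n & matches i g v.
Proof.
elim: n i g => [|n IH] i g g0 ig.
  by exists [::] => // -[|l] //=; rewrite nth_nil.
have [le|gt] := leP (g 0%N) (i.+1%:R * h).
  have [|v sv mv] := IH 0%N (fun l => g l.+1) (fun l => g0 _); first by rewrite mul0r.
  by exists (true :: v) => [|[|l]] /=; rewrite ?sv // ig.
by have [v sv mv] := IH i.+1 g g0 gt; exists (false :: v) => //=; rewrite sv.
Qed.

(** Ring [m] falls in a slot after the first [J]; it ends [m.+1] gaps, each rounded up by less than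
    one slot, which leaves [J - m] slots besides the [i] already elapsed. *)
Lemma matches_lower v i g J m : (forall l, 0 <= g l) -> matches i g v ->
  (J <= size v)%N -> (count id (take J v) <= m)%N ->
  ((i + J)%:R - m%:R) * h <= \sum_(l < m.+1) g l.
Proof.
elim: v i g J m => [|b v IH] i g J m g0 mv Jv cm; last first.
  case: J Jv cm => [|J] /= Jv cm.
    rewrite big_ord_recl (@le_trans _ _ (i%:R * h)) //.
      by rewrite addn0 ler_wpM2r ?(ltW h_gt0) // lerBlDr lerDl.
    by rewrite -[leLHS]addr0 lerD ?sumr_ge0 // ltW // (matches_head mv).
  case: b mv cm => /= [/matches_true[/andP[ig _] mv]|mv] cm.
    case: m cm => // m cm; rewrite big_ord_recl.
    apply: (@le_trans _ _ (i%:R * h + ((0 + J)%:R - m%:R) * h)).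
      by rewrite -mulrDl ler_wpM2r ?(ltW h_gt0) // add0n natrD -!natr1; lra.
    by apply: lerD; [exact: ltW|exact: (IH 0%N (fun l => g l.+1))].
  by rewrite addnS -addSn; apply: IH.
rewrite big_ord_recl (@le_trans _ _ (i%:R * h)) //.
  case: J Jv {cm} => // _.
  by rewrite addn0 ler_wpM2r ?(ltW h_gt0) // lerBlDr lerDl.
by rewrite -[leLHS]addr0 lerD ?sumr_ge0 // ltW // (matches_head mv).
Qed.

(** Rounding up only delays the rings. *)
Lemma matches_upper v i g J m : matches i g v -> (m < count id (take J v))%N ->
  \sum_(l < m.+1) g l <= (i + J)%:R * h.
Proof.
elim: v i g J m => [|b v IH] i g [|J] m //= mv.
case: b mv => /= [/matches_true[/andP[_ ig] mv]|mv] cm; last first.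
  by rewrite addnS -addSn; apply: IH.
rewrite big_ord_recl; case: m cm => [|m] cm.
  rewrite big_ord0 addr0 (le_trans ig) // ler_wpM2r ?(ltW h_gt0) // ler_nat; lia.
have -> : (i + J.+1)%:R * h = i.+1%:R * h + (0 + J)%:R * h.
  by rewrite -mulrDl -natrD; congr (_%:R * _); lia.
by apply: lerD => //; exact: (IH 0%N (fun l => g l.+1)).
Qed.

End Matching.

Section Paths.
Context (R : realType).
Implicit Types (gap : nat -> nat -> R) (T : nat -> R) (s t : R).

Lemma nringsP T s : {homo T : m n / (m <= n)%N >-> m <= n} -> (exists M, s < T M) ->
  forall m, (T m <= s) = (m < nrings T s)%N.
Proof.
move=> Tmono [M sM].
have ex : exists m, s < T m by exists M.
apply: (@xgetPex _ 0%N [set n | forall m, (T m <= s) = (m < n)%N]).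
exists (ex_minn ex); case: ex_minnP => n sn nmin m /=.
have [nm|mn] := leqP n m.
  by apply/negbTE; rewrite -ltNge (lt_le_trans sn) // Tmono.
by rewrite leNgt; apply/negP => /nmin; rewrite leqNgt mn.
Qed.

Lemma ring_time_mono gap k : (forall l, 0 < gap k l) ->
  {homo ring_time gap k : m n / (m <= n)%N >-> m <= n}.
Proof.
move=> g0; apply: homo_leq => // [x y z|n]; first exact: le_trans.
by rewrite /ring_time [leRHS]big_ord_recr lerDl ltW.
Qed.

Lemma ring_time_gt0 gap k m : (forall l, 0 < gap k l) -> 0 < ring_time gap k m.
Proof.
by move=> g0; rewrite /ring_time big_ord_recl ltr_pwDl // sumr_ge0 // => i _; exact: ltW.
Qed.

(* [m] is the last ring at which the particle was blocked. *)
Lemma walk_decomp T occ x0 n :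
  walk T occ x0 n = x0 + n%:Z \/
  exists m, [/\ (m < n)%N, occ (T m) (walk T occ x0 m + 1) &
                walk T occ x0 n = walk T occ x0 m + (n - m.+1)%:Z].
Proof.
elim: n => [|n IH] /=; first by left; rewrite addr0.
case: ifPn => [occn|nocc]; first by right; exists n; rewrite subnn addr0.
case: IH => [->|[m [mn om ->]]]; first by left; lia.
by right; exists m; split=> //; lia.
Qed.

Lemma walk_le T occ x0 n : walk T occ x0 n <= x0 + n%:Z.
Proof.
elim: n => [|n IH] /=; first by rewrite addr0.
rewrite intS addrCA; case: ifP => _; last by rewrite [_ + 1]addrC lerD2l.
by rewrite (le_trans IH) // lerDr.
Qed.

Lemma walk_mono T occ x0 m n : (m <= n)%N -> walk T occ x0 m <= walk T occ x0 n.
Proof.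
move=> /subnK <-; elim: (n - m)%N => [|k IH] //.
apply: le_trans IH _; rewrite addSn /=; case: ifP => _ //.
by rewrite lerDl.
Qed.

Lemma xiE gap k t : xi gap k t = walk (ring_time gap k)
  (if k is j.+1 then fun s y => xi gap j s == y else fun _ _ => false)
  (- k%:Z) (nrings (ring_time gap k) t).
Proof. by case: k. Qed.

Lemma xi_ge gap k t : - k%:Z <= xi gap k t.
Proof. by rewrite xiE (@walk_mono _ _ _ 0). Qed.

Lemma xi_le_nrings gap k t : xi gap k t <= (nrings (ring_time gap k) t)%:Z - k%:Z.
Proof. by rewrite xiE addrC walk_le. Qed.

(** In numbers of jumps: at its last blocked ring the particle of index [k.+1] has jumped as often
    as the one ahead, and every later ring is a jump. *)
Lemma xi_decomp gap k t (N := nrings (ring_time gap k.+1) t) :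
  xi gap k.+1 t + k.+1%:Z = N%:Z \/
  exists2 m, (m < N)%N & xi gap k.+1 t + k.+1%:Z =
      xi gap k (ring_time gap k.+1 m) + k%:Z + (N - m.+1)%:Z.
Proof.
rewrite xiE -/N; case: (walk_decomp (ring_time gap k.+1)
  (fun s y => xi gap k s == y) (- k.+1%:Z) N) => [->|[m [mN /eqP e ->]]].
  by left; lia.
by right; exists m => //; lia.
Qed.

End Paths.

Section CountTake.
Local Notation C v j := (count id (take j v)).

Lemma count_take_mono (v : seq bool) i j : (i <= j)%N -> (C v i <= C v j)%N.
Proof. by move=> /subnKC <-; rewrite takeD count_cat leq_addr. Qed.

Lemma count_take_drop (v : seq bool) d j :
  (C (drop d v) (j - d) + C v d)%N = C v (maxn j d).
Proof. by rewrite maxnC maxnE takeD count_cat addnC. Qed.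

Lemma departures_increment q a v i j : size a = size v -> (i <= j)%N -> (j <= size v)%N ->
  (C (departures q a v) j + C v i <= C (departures q a v) i + C v j)%N.
Proof.
move=> sav /subnKC <-; elim: (j - i)%N => [|k IH] kv; first by rewrite addn0 addnC.
rewrite addnS in kv *; have := IH (ltnW kv); rewrite !count_takeS nth_departures //.
by case: (nth false v _) => /=; lia.
Qed.

Lemma count_take_jump (v : seq bool) m j : (m < C v j)%N ->
  exists J, [/\ (J < j)%N, C v J = m & C v J.+1 = m.+1].
Proof.
elim: j => [|j IH]; first by rewrite take0.
rewrite count_takeS; have [mj|jm] := ltnP m (C v j).
  by have [J [Jj e1 e2]] := IH mj; exists J; split=> //; exact: ltnW.
by case E: nth => mj; last lia; exists j; rewrite count_takeS E; split=> //; lia.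
Qed.

End CountTake.

(** * The lagged discrete tandem stays behind the particles *)

Section LowerPath.
Context (R : realType) (gap : nat -> nat -> R) (h : R) (h_gt0 : 0 < h).
Context (K M n : nat) (t : R) (w : nat -> seq bool).
Context (gap_gt0 : forall k l, (k <= K)%N -> 0 < gap k l).
Context (ring_late : forall k, (k <= K)%N -> t < ring_time gap k M).
Context (w_size : forall k, (k <= K)%N -> size (w k) = (k * M + n)%N).
Context (w_match : forall k, (k <= K)%N -> matches h 0 (gap k) (w k)).

(* Clock [k] is read [k * M] slots late, to make up for the delays (at most [M]
   slots per particle) caused by rounding up the gaps. *)
Let b k := drop (k * M) (w k).

Fixpoint discrete_dep k : seq bool :=
  if k is j.+1 then departures 0 (discrete_dep j) (b j.+1) else b 0.

Let size_b k : (k <= K)%N -> size (b k) = n.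
Proof. by move=> kK; rewrite size_drop w_size // addKn. Qed.

Lemma size_discrete_dep k : (k <= K)%N -> size (discrete_dep k) = n.
Proof.
elim: k => [|k IH] kK /=; first by rewrite size_b.
by rewrite size_departures ?IH ?size_b // ltnW.
Qed.

Local Notation C v j := (count id (take j v)).

Let ring_mono k : (k <= K)%N -> {homo ring_time gap k : m n / (m <= n)%N >-> m <= n}.
Proof. by move=> kK; apply: ring_time_mono => l; exact: gap_gt0. Qed.

Let rings k s m : (k <= K)%N -> s <= t ->
  (ring_time gap k m <= s) = (m < nrings (ring_time gap k) s)%N.
Proof.
move=> kK st; apply: nringsP; first exact: ring_mono.
by exists M; rewrite (le_lt_trans st) // ring_late.
Qed.

Let rings_ge k s j : (k <= K)%N -> s <= t -> j%:R * h <= s ->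
  (C (w k) j <= nrings (ring_time gap k) s)%N.
Proof.
move=> kK st js; case E: (C (w k) j) => [|m] //.
rewrite -rings // (le_trans _ js) // /ring_time -[j in leRHS]add0n.
by apply: matches_upper (w_match kK) _ => //; rewrite E.
Qed.

Let ring_ge k m J : (k <= K)%N -> (J <= size (w k))%N -> (C (w k) J <= m)%N ->
  (J%:R - m%:R) * h <= ring_time gap k m.
Proof.
move=> kK Jw Cm; rewrite /ring_time -[J in leLHS]add0n.
by apply: matches_lower (w_match kK) _ _ => // l; rewrite ltW // gap_gt0.
Qed.

(** Induction on [k], comparing the particle with its queue at the last ring [m] at which it was
    blocked. The true time of that ring is at most [M] slots before its rounded slot, so the
    particle ahead is evaluated [M] slots earlier, which is exactly the additional lag of clock
    [k.+1]. *)
Lemma discrete_dep_le_xi k s j : (k <= K)%N -> s <= t -> (j <= k * M + n)%N ->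
  j%:R * h <= s -> (C (discrete_dep k) (j - k * M))%:Z <= xi gap k s + k%:Z.
Proof.
elim: k s j => [|k IH] s j kK st jn js.
  rewrite xiE; case: (walk_decomp (ring_time gap 0) (fun _ _ => false) (- 0%:Z)
    (nrings (ring_time gap 0) s)) => [->|[m []//]].
  rewrite /= /b mul0n drop0 subn0 oppr0 add0r addr0.
  by have := rings_ge kK st js.
have kK' := ltnW kK.
have szb := size_b kK; have szd := size_discrete_dep kK'.
set d := (k.+1 * M)%N in jn *; set y' := (j - d)%N.
have y'n : (y' <= n)%N by rewrite leq_subLR.
have eqb i : (C (b k.+1) (i - d) + C (w k.+1) d)%N = C (w k.+1) (maxn i d).
  exact: count_take_drop.
have dep_le y : (y <= n)%N -> (C (discrete_dep k.+1) y <= C (discrete_dep k) y)%N.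
  by move=> yn /=; apply: departures_le_arrival; rewrite ?szd ?szb.
case: (xi_decomp gap k s) => [->|[m mN ->]].
  rewrite lez_nat (leq_trans _ (rings_ge kK st js)) //.
  apply: (@leq_trans (C (b k.+1) y')).
    by rewrite /= departures_le_service ?szd ?szb.
  by have := eqb j; rewrite -/y'; case: (leqP d j) => _; lia.
have Tms : ring_time gap k.+1 m <= s by rewrite rings.
have mM : (m < M)%N.
  rewrite ltnNge; apply/negP => Mm; have := ring_late kK; rewrite ltNge => /negP[].
  by rewrite (le_trans _ st) // (le_trans _ Tms) // ring_mono.
have T0 : 0 < ring_time gap k.+1 m by apply: ring_time_gt0 => l; exact: gap_gt0.
(* The loss of [m] slots in [matches_lower] is at most [M - 1]; when the truncated subtraction
   vanishes, positivity of the ring time is enough. *)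
have Tslot i : (i <= d + n)%N -> (C (w k.+1) i <= m)%N ->
    (i.+1 - M)%:R * h <= ring_time gap k.+1 m.
  move=> idn Cim; have := ring_ge kK _ Cim; rewrite w_size // => /(_ idn).
  have [Mi|iM] := leqP M i.+1; last first.
    by rewrite (eqP (ltnW iM : _ - _ == 0)%N) mul0r => _; exact: ltW.
  apply: le_trans; rewrite ler_wpM2r ?(ltW h_gt0) // natrB // -natr1.
  by have : m.+1%:R <= M%:R :> R; [rewrite ler_nat|rewrite -natr1; lra].
have Tt : ring_time gap k.+1 m <= t by exact: le_trans st.
have late i : (i < d + n)%N -> (i.+1 - M <= k * M + n)%N.
  by rewrite /d mulSn; move: mM; clear; lia.
(* Either the rounded ring [m] falls after the first [j] slots, or it falls in a slot [J < j]. *)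
have [Cj|/count_take_jump[J [Jj CJ CJ1]]] := leqP (C (w k.+1) j) m.
  have jM : (j - M <= k * M + n)%N by move: jn; rewrite /d mulSn; lia.
  have Tj : (j - M)%:R * h <= ring_time gap k.+1 m.
    rewrite (le_trans _ (Tslot _ jn Cj)) // ler_wpM2r ?(ltW h_gt0) // ler_nat.
    by rewrite leq_sub2r.
  have := IH (ring_time gap k.+1 m) (j - M)%N kK' Tt jM Tj.
  rewrite -subnDA -mulSn -/d -/y' => H.
  apply: (@le_trans _ _ (C (discrete_dep k) y')%:Z); first by rewrite lez_nat dep_le.
  by apply: le_trans H _; rewrite lerDl.
have J1 : (J.+1 - d <= y')%N by rewrite leq_sub2r.
have Jdn : (J < d + n)%N by exact: leq_trans jn.
have := IH (ring_time gap k.+1 m) (J.+1 - M)%N kK' Tt (late _ Jdn) (Tslot _ (ltnW Jdn) _).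
have -> : (J.+1 - M - k * M)%N = (J.+1 - d)%N by rewrite /d mulSn subnDA.
rewrite CJ => /(_ (leqnn _)) H.
(* Up to the slot of ring [m] the queue has let out at most what it received; afterwards each
   departure uses a service, hence a later ring. *)
apply: (@le_trans _ _ ((C (discrete_dep k) (J.+1 - d))%:Z +
    (nrings (ring_time gap k.+1) s - m.+1)%:Z)); last by rewrite lerD2r.
rewrite -PoszD lez_nat.
have := dep_le _ (leq_trans J1 y'n).
have := @departures_increment 0 (discrete_dep k) (b k.+1) _ _ _ J1.
rewrite szb szd => /(_ erefl y'n) /=.
have := rings_ge kK st js; have := eqb j; have := eqb J.+1; rewrite -/y'.
have := count_take_mono (w k.+1) Jj; have := count_take_mono (w k.+1) (leq_maxr j d).
have := count_take_mono (w k.+1) (leq_maxl J.+1 d).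
set N := nrings _ _; rewrite -CJ1.
case: (leqP d J.+1) => dJ; case: (leqP d j) => dj; lia.
Qed.

End LowerPath.

(** * Order of the particles *)

Section Ordering.
Context (R : realType) (gap : nat -> nat -> R).
Context (gap_gt0 : forall k l, 0 < gap k l).
Context (ring_unbounded : forall k (s : R), exists M, s < ring_time gap k M).
Implicit Types (s t : R).

Let ringsP k s m : (ring_time gap k m <= s) = (m < nrings (ring_time gap k) s)%N.
Proof. by apply: nringsP => //; exact: ring_time_mono. Qed.

Lemma nrings_mono k s t : s <= t ->
  (nrings (ring_time gap k) s <= nrings (ring_time gap k) t)%N.
Proof.
move=> st; case E: (nrings _ s) => [|m] //.
by rewrite -ringsP (le_trans _ st) // ringsP E.
Qed.

Lemma xi_mono k s t : s <= t -> xi gap k s <= xi gap k t.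
Proof. by move=> st; rewrite !xiE walk_mono // nrings_mono. Qed.

(** The walk is followed from ring to ring and compared with the particle ahead at the time of the
    last ring; between rings the latter can only move right. *)
Lemma xi_order k t : xi gap k.+1 t < xi gap k t.
Proof.
have key n : walk (ring_time gap k.+1) (fun s y => xi gap k s == y) (- k.+1%:Z) n <
   (if n is m.+1 then xi gap k (ring_time gap k.+1 m) else - k%:Z).
  elim: n => [|n IH] /=; first by lia.
  set x := walk _ _ _ _ in IH *.
  have : x < xi gap k (ring_time gap k.+1 n).
    apply: lt_le_trans IH _; case: n @x => [|n] x; first exact: xi_ge.
    exact/xi_mono/ring_time_mono.
  case: ifPn => [/eqP ->|]; first by rewrite ltrDl.
  by lia.
rewrite xiE; case E: (nrings _ t) (key (nrings (ring_time gap k.+1) t)) => [|m].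
  by move=> /lt_le_trans; apply; exact: xi_ge.
by move=> /lt_le_trans; apply; apply: xi_mono; rewrite ringsP E.
Qed.

Lemma xi_label j k t : (j <= k)%N -> xi gap k t + k%:Z <= xi gap j t + j%:Z.
Proof.
move=> /subnK <-; elim: (k - j)%N => [|d IH]; first by rewrite add0n.
by rewrite (le_trans _ IH) // addSn; have := xi_order (d + j) t; lia.
Qed.

Lemma xi_le_of_ring_time j k m t : (j <= k)%N -> t < ring_time gap j m ->
  xi gap k t <= m%:Z - k%:Z.
Proof.
move=> jk tm; have : (nrings (ring_time gap j) t <= m)%N.
  by rewrite leqNgt -ringsP -ltNge.
by have := xi_label t jk; have := xi_le_nrings gap j t; lia.
Qed.

End Ordering.

Section NumBeyond.
Context (R : realType).
Implicit Types (gap : nat -> nat -> R) (c t : R).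

Lemma num_beyond_ge gap c t (x : R) k : x <= k.+1%:R -> c * t < (xi gap k t)%:~R ->
  (x%:E <= num_beyond gap c t)%E.
Proof.
move=> xk ctk; rewrite /num_beyond le_max; apply/orP; right.
apply: (@le_trans _ _ (k.+1%:R)%:E); first by rewrite lee_fin.
by apply: ereal_sup_ubound; exists k.+1.
Qed.

Lemma num_beyond_gt gap c t (x : R) : (x%:E < num_beyond gap c t)%E <->
  x < 0 \/ exists2 k, x < k.+1%:R & c * t < (xi gap k t)%:~R.
Proof.
rewrite /num_beyond lt_max lte_fin; split=> [/orP[->|]|[->//|[k xk ctk]]]; first by left.
  move=> /ereal_sup_gt[_ [[|k] [//= _ ctk] <-]]; rewrite lte_fin => xk.
  by right; exists k.
apply/orP; right; apply: (@lt_le_trans _ _ (k.+1%:R)%:E); first by rewrite lte_fin.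
by apply: ereal_sup_ubound; exists k.+1.
Qed.

End NumBeyond.

(** * Measurability *)

Section Measurability.
Context d (Omega : measurableType d) (R : realType).
Context (gap : nat -> nat -> Omega -> R).
Context (mgap : forall k l, measurable_fun setT (gap k l)).
Local Notation path w := (fun k n => gap k n w).

Lemma measurable_ring_time k m : measurable_fun setT (fun w => ring_time (path w) k m).
Proof. by apply: measurable_sum => i; exact: mgap. Qed.

Lemma measurable_set_le (f g : Omega -> R) : measurable_fun setT f ->
  measurable_fun setT g -> measurable [set w | f w <= g w].
Proof.
move=> mf mg; have := measurable_funB mg mf measurableT (measurable_itv `[0, +oo[).
rewrite setTI; congr measurable; apply/seteqP.
by split=> w /=; rewrite in_itv /= andbT subr_ge0.
Qed.

Lemma measurable_nrings k (f : Omega -> R) n : measurable_fun setT f ->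
  measurable [set w | nrings (ring_time (path w) k) (f w) = n].
Proof.
move=> mf.
pose A i := [set w | forall m, (ring_time (path w) k m <= f w) = (m < i)%N].
have mA i : measurable (A i).
  rewrite (_ : A i = \bigcap_m (if (m < i)%N then [set w | ring_time (path w) k m <= f w]
     else ~` [set w | ring_time (path w) k m <= f w])); last first.
    apply/seteqP; split=> [w Aw m _|w Aw m].
      by case: ifPn => im /=; rewrite Aw ?(negbTE im).
    by have := Aw m I; case: ifPn => _ //= /negP/negbTE.
  apply: bigcapT_measurable => m; have := measurable_set_le (measurable_ring_time k m) mf.
  by case: ifP => _ //; exact: measurableC.
have Auniq i j w : A i w -> A j w -> i = j.
  by move=> Ai Aj; have := Aj i; have := Ai j; rewrite (Ai i) (Aj j) !ltnn; lia.
have eqn i w : A i w -> nrings (ring_time (path w) k) (f w) = i.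
  move=> Ai; apply: (Auniq _ _ w) => //.
  exact: (@xgetI _ 0%N [set n | forall m, (ring_time (path w) k m <= f w) = (m < n)%N] i).
(* The default value of [nrings] puts all paths without a count into the case [n = 0]. *)
rewrite (_ : mkset _ = A n `|` (if n == 0%N then ~` \bigcup_i A i else set0)); last first.
  apply/seteqP; split=> [w <-|w [/eqn //|]]; last first.
    case: ifP => // /eqP -> /= nA; rewrite /nrings; case: xgetP => // i _ Ai.
    by case: nA; exists i.
  have [[i Ai]|nA] := pselect (exists i, A i w); first by left; rewrite (eqn i w Ai).
  right; rewrite /nrings; case: xgetP => [i _ Ai|_]; first by case: nA; exists i.
  by rewrite eqxx => -[i _ Ai]; apply: nA; exists i.
apply: measurableU => //; case: ifP => _ //.
by apply: measurableC; exact: bigcupT_measurable.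
Qed.

Lemma measurable_walk k (occ : Omega -> R -> int -> bool) x0 n y :
  (forall m y, measurable [set w | occ w (ring_time (path w) k m) y]) ->
  measurable [set w | walk (ring_time (path w) k) (occ w) x0 n = y].
Proof.
move=> mocc; elim: n y => [|n IH] y /=.
  have [->|ne] := eqVneq x0 y; first by rewrite (_ : mkset _ = setT) //; apply/seteqP.
  by rewrite (_ : mkset _ = set0) //; apply/seteqP; split=> // w /eqP; rewrite (negbTE ne).
pose W w := walk (ring_time (path w) k) (occ w) x0 n.
rewrite (_ : mkset _ = ([set w | W w = y] `&` [set w | occ w (ring_time (path w) k n) (y + 1)])
   `|` ([set w | W w = y - 1] `\` [set w | occ w (ring_time (path w) k n) y])).
  by apply: measurableU; [exact: measurableI|exact: measurableD].
apply/seteqP; split=> w /=; rewrite -/(W w).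
  by case: ifPn => o <-; [left|right; rewrite addrK; split=> //; exact/negP].
by move=> [[-> ->]//|[->]]; rewrite subrK => /negP/negbTE ->.
Qed.

(** The time is random because the walk of the particle behind looks at this one at its own ring
    times. *)
Lemma measurable_xi k (f : Omega -> R) y : measurable_fun setT f ->
  measurable [set w | xi (path w) k (f w) = y].
Proof.
elim: k f y => [|k IH] f y mf.
  rewrite (_ : mkset _ = \bigcup_n ([set w | nrings (ring_time (path w) 0) (f w) = n] `&`
    [set w | walk (ring_time (path w) 0) (fun _ _ => false) (- 0%:Z) n = y])).
    apply: bigcupT_measurable => n; apply: measurableI; first exact: measurable_nrings.
    apply: (@measurable_walk 0 (fun _ _ _ => false)) => m z.
    by rewrite (_ : mkset _ = set0); [exact: measurable0|apply/seteqP; split].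
  apply/seteqP; split=> w; first by rewrite /= => <-; eexists; last by split; reflexivity.
  by move=> [n _ [<- /= <-]].
rewrite (_ : mkset _ = \bigcup_n ([set w | nrings (ring_time (path w) k.+1) (f w) = n] `&`
    [set w | walk (ring_time (path w) k.+1) (fun s y => xi (path w) k s == y)
       (- k.+1%:Z) n = y])).
  apply: bigcupT_measurable => n; apply: measurableI; first exact: measurable_nrings.
  apply: (@measurable_walk k.+1 (fun w s y => xi (path w) k s == y)) => m z.
  rewrite (_ : mkset _ = [set w | xi (path w) k (ring_time (path w) k.+1 m) = z]).
    exact/IH/measurable_ring_time.
  by apply/seteqP; split=> w /eqP.
apply/seteqP; split=> w; first by rewrite /= => <-; eexists; last by split; reflexivity.
by move=> [n _ [<- /= <-]].
Qed.

Lemma measurable_num_beyond c t : measurable_fun setT (fun w => num_beyond (path w) c t).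
Proof.
apply: (measurability _ (ErealGenOInfty.measurableE R)) => // _ [_ [x ->] <-].
rewrite setTI.
rewrite (_ : _ @^-1` _ = [set w | x < 0] `|` \bigcup_k \bigcup_(y : int)
   [set w | [/\ xi (path w) k t = y, x < k.+1%:R & c * t < y%:~R]]); last first.
  apply/seteqP; split=> w /=; rewrite in_itv /= andbT num_beyond_gt.
    by move=> [|[k xk ctk]]; [left|right; exists k => //; exists (xi (path w) k t)].
  by move=> [|[k _ [y _ [e xk cty]]]]; [left|right; exists k => //; rewrite e].
have mP (Q : Prop) : measurable [set w : Omega | Q].
  have [q|nq] := pselect Q.
    by rewrite (_ : mkset _ = setT); [exact: measurableT|apply/seteqP; split].
  by rewrite (_ : mkset _ = set0); [exact: measurable0|apply/seteqP; split].
apply: measurableU => //; apply: bigcupT_measurable => k.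
apply: countable_bigcupT_measurable => // y.
rewrite (_ : mkset _ = [set w | xi (path w) k t = y] `&`
    [set w | x < k.+1%:R /\ c * t < y%:~R]).
  by apply: measurableI => //; exact: measurable_xi.
by apply/seteqP; split=> w /= => [[] // | [? []]].
Qed.

End Measurability.

(** * The law of the discretized clocks *)

Section ExponentialSlots.
Context (R : realType) (p : R) (p_gt0 : 0 < p).

Let mu : probability _ R :=
  exponential_distribution_exponential_prob__canonical__probability_measure_Probability p_gt0.

Let muU (A B : set R) : measurable A -> measurable B -> A `&` B = set0 ->
  mu (A `|` B) = (mu A + mu B)%E.
Proof. by move=> mA mB AB; rewrite (measureU mu). Qed.

Lemma exponential_prob_itvNyc (b : R) : 0 <= b ->
  exponential_prob p [set x | x <= b] = (1 - expR (- (p * b)))%:E.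
Proof.
move=> b0.
have neg : mu [set x | x < 0] = 0%E.
  by apply: integral0_eq => x /= x0; rewrite lt0_exponential_pdf.
have setE (a : R) : [set x : R | x <= a] = `]-oo, a]%classic.
  by apply/seteqP; split=> x /=; rewrite in_itv.
have negE : [set x : R | x < 0] = `]-oo, 0[%classic.
  by apply/seteqP; split=> x /=; rewrite in_itv.
change (mu [set x | x <= b] = (1 - expR (- (p * b)))%:E).
have [->|bn0] := eqVneq b 0.
  rewrite mulr0 oppr0 expR0 subrr.
  rewrite (_ : mkset _ = [set x | x < 0] `|` [set 0]); last first.
    apply/seteqP; split=> x /=; first by rewrite le_eqVlt => /orP[/eqP ->|]; [right|left].
    by move=> [/ltW//|->].
  rewrite muU //; first by rewrite neg add0e; exact: integral_set1.
    by rewrite negE; exact: measurable_itv.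
  by apply/seteqP; split=> x //= [x0 e]; rewrite e ltxx in x0.
have b1 : 0 < b by rewrite lt_neqAle eq_sym bn0.
rewrite (_ : mkset _ = [set x | x < 0] `|` `[0, b]%classic); last first.
  apply/seteqP; split=> x /=; rewrite in_itv /=.
    by case: (leP 0 x) => x0 xb; [right; rewrite xb|left].
  by move=> [/ltW /le_trans->//|/andP[]].
rewrite muU //; first by rewrite neg add0e EFinB -mulNr; exact: exponential_prob_itv0c.
  by rewrite negE; exact: measurable_itv.
by apply/seteqP; split=> x //= [x0]; rewrite in_itv /= => /andP[]; rewrite leNgt x0.
Qed.

Lemma exponential_prob_setT : exponential_prob p setT = 1%E.
Proof. exact: (probability_setT mu). Qed.

Lemma exponential_prob_itvoy (a : R) : 0 <= a ->
  exponential_prob p [set x | a < x] = (expR (- (p * a)))%:E.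
Proof.
move=> a0; change (mu [set x | a < x] = (expR (- (p * a)))%:E).
rewrite (_ : mkset _ = ~` [set x | x <= a]); last first.
  by apply/seteqP; split=> x /=; rewrite ltNge => /negP.
rewrite probability_setC.
  by rewrite /mu /= exponential_prob_itvNyc // -EFinB opprB addrC subrK.
by rewrite (_ : mkset _ = `]-oo, a]%classic) //; apply/seteqP; split=> x /=; rewrite in_itv.
Qed.

Lemma exponential_prob_itvoc (a b : R) : 0 <= a -> a <= b ->
  exponential_prob p [set x | a < x <= b] = (expR (- (p * a)) - expR (- (p * b)))%:E.
Proof.
move=> a0 ab; have b0 := le_trans a0 ab.
have mle (c : R) : measurable [set x : R | x <= c].
  by rewrite (_ : mkset _ = `]-oo, c]%classic) //; apply/seteqP; split=> x /=; rewrite in_itv.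
have moc : measurable [set x : R | a < x <= b].
  by rewrite (_ : mkset _ = `]a, b]%classic) //; apply/seteqP; split=> x /=; rewrite in_itv.
have : mu [set x | x <= b] = (mu [set x | (x <= a)%R] + mu [set x | (a < x <= b)%R])%E.
  rewrite -muU //.
    congr (mu _); apply/seteqP; split=> x /=.
      by case: (leP x a); [left|right].
    by move=> [/le_trans->//|/andP[]].
  by apply/seteqP; split=> x //= [xa]; rewrite ltNge xa.
rewrite /mu /= !exponential_prob_itvNyc //.
case: (exponential_prob p _) => [r|//|//]; rewrite -EFinD => -[e].
by congr (_%:E); lra.
Qed.

(** Lack of memory: each new slot contains a ring with probability [1 - expR (- (p * h))], whatever
    has elapsed. The exponential factor accounts for the [i] slots already elapsed, and the factors
    beyond the constrained gaps are one. *)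
Lemma exponential_prob_gap_slots (h : R) i v N : 0 < h -> (count id v <= N)%N ->
  (\prod_(0 <= l < N.+1) exponential_prob p (nth setT (gap_slots h i v) l))%E =
  (expR (- (p * (i%:R * h))) * word_weight (1 - expR (- (p * h))) v)%:E.
Proof.
move=> h0.
elim: v i N => [|b v IH] i N /= cN.
  rewrite big_nat_recl // /word_weight big_nil mulr1 /= exponential_prob_itvoy ?mulr_ge0 ?(ltW h0) //.
  rewrite big1 ?mule1 // => l _; rewrite nth_nil; exact: exponential_prob_setT.
have wtc : word_weight (1 - expR (- (p * h))) (b :: v) =
   (if b then 1 - expR (- (p * h)) else expR (- (p * h))) * word_weight (1 - expR (- (p * h))) v.
  by rewrite /word_weight big_cons subKr.
have split_exp : expR (- (p * (i.+1%:R * h))) = expR (- (p * (i%:R * h))) * expR (- (p * h)).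
  by rewrite -expRD -natr1; congr expR; ring.
rewrite wtc; case: b cN {wtc} => /= cN; last by rewrite IH // split_exp -[X in X%:E = _]mulrA.
case: N cN => // N cN.
rewrite big_nat_recl // /= IH // mul0r mulr0 oppr0 expR0 mul1r.
rewrite exponential_prob_itvoc ?mulr_ge0 ?(ltW h0) //; last first.
  by rewrite ler_wpM2r ?(ltW h0) // ler_nat.
by rewrite -EFinM split_exp; congr (_%:E); ring.
Qed.

End ExponentialSlots.

Section WordLists.
Context (R : realType).
Implicit Types (ks : seq nat) (N : nat -> nat) (ws : seq (seq bool)).

Fixpoint word_lists (ns : seq nat) : seq (seq (seq bool)) :=
  if ns is n :: ns' then [seq v :: vs | v <- words n, vs <- word_lists ns'] else [:: [::]].

Definition word_of ks ws (k : nat) := nth [::] ws (index k ks).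

Lemma mem_word_lists ns ws : (ws \in word_lists ns) = (map size ws == ns).
Proof.
elim: ns ws => [|n ns IH] [|v ws] //=.
  by apply/negP => /allpairsP[[a b] []].
rewrite eqseq_cons -IH -mem_words; apply/allpairsP/andP => [[[a b] /= [h1 h2 [-> ->]]]|[h1 h2]] //.
by exists (v, ws).
Qed.

Lemma words_mean_word_lists ks N (be : nat -> R) f : uniq ks ->
  words_mean [seq (N k, be k) | k <- ks] f =
  \sum_(ws <- word_lists [seq N k | k <- ks])
    (\prod_(k <- ks) word_weight (be k) (word_of ks ws k)) * f ws.
Proof.
elim: ks f => [|k ks IH] f /=; first by rewrite big_seq1 big_nil mul1r.
move=> /andP[kks uks]; rewrite big_allpairs_dep /word_mean; apply: eq_bigr => v _.
rewrite IH // mulr_sumr; apply: eq_bigr => ws _; rewrite mulrA big_cons; congr (_ * _ * _).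
  by rewrite /word_of /= eqxx.
rewrite big_seq [RHS]big_seq; apply: eq_bigr => j jks; rewrite /word_of /=.
by rewrite ifN //; apply: contraNneq kks => ->.
Qed.

End WordLists.

Section Clocks.
Context d (Omega : measurableType d) (R : realType) (P : probability Omega R).
Context (rate : nat -> {RV P >-> R}) (gap : nat -> nat -> {RV P >-> R}).
Context (clocks : poisson_clocks_given rate gap).
Implicit Types (G : set Omega) (h p : R) (ks : seq nat).

Definition slot_prob h p : R := 1 - expR (- (p * h)).

Lemma sigma_of_measurable G : sigma_of rate G -> measurable G.
Proof.
apply: smallest_sub; first exact: sigma_algebra_measurable.
move=> _ [k _ [A mA <-]]; rewrite -[X in measurable X]setTI.
exact: measurable_funPT.
Qed.

Lemma measurable_gap_slots h i v l : measurable (nth setT (gap_slots h i v) l).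
Proof.
have mo (x y : R) : measurable [set z : R | x < z <= y].
  by rewrite (_ : mkset _ = `]x, y]%classic) //; apply/seteqP; split=> z /=; rewrite in_itv.
have my (x : R) : measurable [set z : R | x < z].
  by rewrite (_ : mkset _ = `]x, +oo[%classic) //; apply/seteqP; split=> z /=; rewrite in_itv /= andbT.
elim: v i l => [|b v IH] i l; first by case: l => [|l] //=; rewrite nth_nil.
by case: b => /=; [case: l => [|l]; [exact: mo|exact: IH]|exact: IH].
Qed.

Definition all_match h ks (w : nat -> seq bool) : set Omega :=
  [set o | forall k, k \in ks -> matches h 0 (fun l => gap k l o) (w k)].

Lemma measurable_gap_preimage k l (B : set R) : measurable B -> measurable (gap k l @^-1` B).
Proof. by move=> mB; rewrite -[X in measurable X]setTI; exact: measurable_funPT. Qed.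

Lemma measurable_all_match h ks w : measurable (all_match h ks w).
Proof.
rewrite (_ : all_match h ks w = \bigcap_k \bigcap_l
    (if k \in ks then gap k l @^-1` nth setT (gap_slots h 0 (w k)) l else setT)).
  apply: bigcapT_measurable => k; apply: bigcapT_measurable => l.
  by case: ifP => _ //; apply: measurable_gap_preimage; exact: measurable_gap_slots.
apply/seteqP; split=> o /=; first by move=> H k _ l _; case: ifPn => // /H; exact.
by move=> H k kks l; have := H k I l I; rewrite kks.
Qed.

(** [gap_slots] constrains finitely many gaps of each clock, so the event is a finite intersection
    to which [clocks] applies; by [exponential_prob_gap_slots] each clock contributes the weight of
    its word. *)
Lemma prob_all_match G h ks w : sigma_of rate G -> 0 < h -> uniq ks ->
  (forall o, G o -> forall k, k \in ks -> 0 < rate k o) ->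
  P (G `&` all_match h ks w) =
  (\int[P]_(o in G) (\prod_(k <- ks) word_weight (slot_prob h (rate k o)) (w k))%:E)%E.
Proof.
move=> sG h0 uks rate0.
pose N := (\max_(k <- ks) size (w k))%N.
pose s := [seq (k, l) | k <- ks, l <- index_iota 0 N.+1].
pose J := [fset x in s]%fset.
pose B (j : nat * nat) := nth setT (gap_slots h 0 (w j.1)) j.2.
have Nk k : k \in ks -> (size (w k) <= N)%N by move=> kks; exact: leq_bigmax_seq.
have us : uniq s by apply: allpairs_uniq => //; [exact: iota_uniq|move=> [a b] [a' b'] _ _].
have -> : G `&` all_match h ks w = G `&` \bigcap_(j in [set` J]) gap j.1 j.2 @^-1` B j.
  congr (_ `&` _); apply/seteqP; split=> o H.
    move=> [k l] /=; rewrite in_fset => /allpairsP[[k' l'] /= [kks _ [-> ->]]].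
    exact: H.
  move=> k kks l; have [lN|Nl] := ltnP l N.+1; last first.
    rewrite nth_default // size_gap_slots (leq_trans _ Nl) // ltnS (leq_trans (count_size _ _)) //.
    exact: Nk.
  apply: (H (k, l)); rewrite /= in_fset; apply/allpairsP; exists (k, l).
  by rewrite mem_index_iota.
rewrite (clocks J sG); last by move=> j; exact: measurable_gap_slots.
apply: eq_integral => o; rewrite inE => Go.
have perm_J : perm_eq (enum_fset J) s.
  by apply: uniq_perm => // x; rewrite in_fset.
rewrite (perm_big _ perm_J) /= big_allpairs_dep -prodEFin big_seq [RHS]big_seq.
apply: eq_bigr => k kks.
have := @exponential_prob_gap_slots R _ (rate0 o Go k kks) h 0 (w k) N h0.
rewrite (leq_trans (count_size _ _)) ?Nk // mul0r mulr0 oppr0 expR0 mul1r.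
exact.
Qed.

Lemma measurable_slot_prob_weight h k v :
  measurable_fun setT (fun o => word_weight (slot_prob h (rate k o)) v).
Proof.
apply: measurable_prod => -[] _.
  apply: measurable_funB => //; apply: measurableT_comp => //.
  by apply: measurable_funN; exact: measurable_funM.
apply: measurable_funB => //; apply: measurable_funB => //; apply: measurableT_comp => //.
by apply: measurable_funN; exact: measurable_funM.
Qed.

Lemma le_measure_bigsetU (I : Type) (r : seq I) (Q : pred I) (A : I -> set Omega) :
  (forall i, measurable (A i)) ->
  (P (\big[setU/set0]_(i <- r | Q i) A i) <= \sum_(i <- r | Q i) P (A i))%E.
Proof.
move=> mA; elim: r => [|i r IH]; first by rewrite !big_nil measure0.
rewrite !big_cons; case: ifP => // _.
apply: le_trans (leeD2l _ IH); apply: measureU2 => //.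
exact: bigsetU_measurable.
Qed.

Lemma slot_prob_ge0 h p : 0 <= h -> 0 <= p -> 0 <= slot_prob h p <= 1.
Proof.
move=> h0 p0; rewrite /slot_prob gerBl expR_ge0 subr_ge0 -expR0 ler_expR.
by rewrite oppr_le0 mulr_ge0.
Qed.

(** The passage from words to [P]: on [G], the event is covered by the finitely many events that the
    clocks match a bad list of words, and their probabilities add up to the integral of a
    [words_mean]. *)
Lemma prob_words_le G (Ev : set Omega) h ks (N : nat -> nat) (bad : pred (seq (seq bool)))
    (C : Omega -> R) :
  sigma_of rate G -> 0 < h -> uniq ks ->
  (forall o, G o -> forall k, k \in ks -> 0 < rate k o) ->
  measurable Ev -> measurable_fun G C ->
  (forall o, Ev o -> exists ws, [/\ map size ws = map N ks,
     all_match h ks (word_of ks ws) o & bad ws]) ->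
  (forall o, G o -> words_mean [seq (N k, slot_prob h (rate k o)) | k <- ks]
      (fun ws => (bad ws)%:R) <= C o) ->
  (P (G `&` Ev) <= \int[P]_(o in G) (C o)%:E)%E.
Proof.
move=> sG h0 uks rate0 mEv mC EvP le_C.
have mG := sigma_of_measurable sG.
pose L := word_lists (map N ks).
pose A ws := G `&` all_match h ks (word_of ks ws).
have mA ws : measurable (A ws) by apply: measurableI => //; exact: measurable_all_match.
apply: (@le_trans _ _ (P (\big[setU/set0]_(ws <- L | bad ws) A ws))).
  apply: le_measure; rewrite ?inE; first exact: measurableI.
    by apply: bigsetU_measurable => ws _; exact: mA.
  move=> o [Go /EvP[ws [sws mws bws]]].
  rewrite -bigcup_seq_cond; exists ws => //=.
  by rewrite mem_word_lists sws eqxx bws.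
apply: (le_trans (le_measure_bigsetU _ _ mA)).
under eq_bigr do rewrite prob_all_match //.
have mF ws : measurable_fun G (fun o =>
    (\prod_(k <- ks) word_weight (slot_prob h (rate k o)) (word_of ks ws k))%:E).
  apply/measurable_EFinP; apply: measurable_funTS; apply: measurable_prod => k _.
  exact: measurable_slot_prob_weight.
have F0 ws o : G o -> (0 <= (\prod_(k <- ks) word_weight (slot_prob h (rate k o)) (word_of ks ws k))%:E)%E.
  move=> Go; rewrite lee_fin big_seq prodr_ge0 // => k kks.
  by apply/word_weight_ge0/slot_prob_ge0; rewrite ltW // rate0.
rewrite -big_filter -ge0_integral_sum //.
apply: ge0_le_integral => //.
- by move=> o Go; apply: sume_ge0 => ws _; exact: F0.
- by apply: emeasurable_sum => ws _; exact: mF.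
- by apply/measurable_EFinP.
move=> o Go; rewrite sumEFin lee_fin; apply: le_trans (le_C o Go).
rewrite (words_mean_word_lists N (fun k => slot_prob h (rate k o))) // big_filter big_mkcond.
by rewrite le_eqVlt; apply/orP; left; apply/eqP/eq_bigr => ws _; case: (bad ws); rewrite ?mulr1 ?mulr0.
Qed.

End Clocks.

(** * Positivity of the gaps and tails of ring times *)

Section RingTimes.
Context d (Omega : measurableType d) (R : realType) (P : probability Omega R).
Context (rate : nat -> {RV P >-> R}) (gap : nat -> nat -> {RV P >-> R}).
Context (clocks : poisson_clocks_given rate gap).
Implicit Types (G : set Omega) (h p t : R).
Local Notation path o := (fun k l => gap k l o).

Definition all_positive : set Omega := [set o | forall k l, 0 < gap k l o].

Lemma measurable_le_set (X : {RV P >-> R}) (x : R) : measurable [set o | X o <= x].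
Proof.
rewrite (_ : mkset _ = X @^-1` `]-oo, x]%classic); last first.
  by apply/seteqP; split=> o /=; rewrite in_itv.
by rewrite -[X in measurable X]setTI; exact: measurable_funPT.
Qed.

Lemma measurable_gt_set (X : {RV P >-> R}) (x : R) : measurable [set o | x < X o].
Proof.
rewrite (_ : mkset _ = ~` [set o | X o <= x]); first exact/measurableC/measurable_le_set.
by apply/seteqP; split=> o /=; rewrite ltNge => /negP.
Qed.

Lemma sigma_of_preimage k (A : set R) : measurable A -> sigma_of rate (rate k @^-1` A).
Proof. by move=> mA; apply: sub_sigma_algebra; exists k => //; exists A. Qed.

Lemma sigma_of_gt k (x : R) : sigma_of rate [set o | x < rate k o].
Proof.
rewrite (_ : mkset _ = rate k @^-1` `]x, +oo[%classic); first exact: sigma_of_preimage.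
by apply/seteqP; split=> o /=; rewrite in_itv /= andbT.
Qed.

Lemma sigma_of_le k (x : R) : sigma_of rate [set o | rate k o <= x].
Proof.
rewrite (_ : mkset _ = rate k @^-1` `]-oo, x]%classic); first exact: sigma_of_preimage.
by apply/seteqP; split=> o /=; rewrite in_itv.
Qed.

Lemma sigma_of_bigcap (A : nat -> set Omega) : (forall i, sigma_of rate (A i)) ->
  sigma_of rate (\bigcap_i A i).
Proof.
move=> sA; rewrite -[X in sigma_of _ X]setCK setC_bigcap.
by apply: sigma_algebraC; apply: sigma_algebra_bigcup => i; apply: sigma_algebraC; exact: sA.
Qed.

Lemma sigma_of_setI (A B : set Omega) : sigma_of rate A -> sigma_of rate B ->
  sigma_of rate (A `&` B).
Proof.
move=> sA sB; rewrite -bigcap2E; apply: sigma_of_bigcap => -[|[|i]] //=.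
by rewrite -setC0; apply: sigma_algebraC; exact: sigma_algebra0.
Qed.

Lemma measurable_all_positive : measurable all_positive.
Proof.
rewrite (_ : all_positive = \bigcap_k \bigcap_l [set o | 0 < gap k l o]).
  by apply: bigcapT_measurable => k; apply: bigcapT_measurable => l; exact: measurable_gt_set.
by apply/seteqP; split=> o H; [move=> k _ l _; exact: H|move=> k l; exact: (H k I l I)].
Qed.

Lemma prob_gap_le0 k l : P [set o | rate k o <= 0] = 0%E -> P [set o | gap k l o <= 0] = 0%E.
Proof.
move=> rate0; apply/eqP; rewrite eq_le measure_ge0 andbT.
pose G := [set o | 0 < rate k o].
pose J := [fset (k, l)]%fset.
have mB : measurable [set x : R | x <= 0].
  by rewrite (_ : mkset _ = `]-oo, 0]%classic) //; apply/seteqP; split=> x /=; rewrite in_itv.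
have := clocks J (sigma_of_gt k 0) (fun _ => mB); rewrite bigcap_fset big_seq_fset1 => /= e.
have {}e : P (G `&` [set o | gap k l o <= 0]) = 0%E.
  rewrite [LHS]e; apply: integral0_eq => o /= ro.
  by rewrite big_seq_fset1 exponential_prob_itvNyc // mulr0 oppr0 expR0 subrr.
apply: (@le_trans _ _ (P (G `&` [set o | gap k l o <= 0] `|` [set o | rate k o <= 0]))).
  apply: le_measure; rewrite ?inE.
  - exact: measurable_le_set.
  - apply: measurableU; last exact: measurable_le_set.
    by apply: measurableI; [exact: measurable_gt_set|exact: measurable_le_set].
  move=> o /= go; case: (leP (rate k o) 0) => ro; [by right|by left].
have mGg : measurable (G `&` [set o | gap k l o <= 0]).
  by apply: measurableI; [exact: measurable_gt_set|exact: measurable_le_set].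
have := measureU2 P mGg (measurable_le_set (rate k) 0).
by rewrite /= [X in (_ <= X + _)%E -> _]e [X in (_ <= _ + X)%E -> _]rate0 adde0.
Qed.

Lemma prob_not_all_positive : (forall k, P [set o | rate k o <= 0] = 0%E) ->
  P (~` all_positive) = 0%E.
Proof.
move=> rate0; apply/negligibleP; first exact/measurableC/measurable_all_positive.
rewrite (_ : ~` _ = \bigcup_k \bigcup_l [set o | gap k l o <= 0]).
  apply: negligible_bigcup => k; apply: negligible_bigcup => l.
  by apply/negligibleP; [exact: measurable_le_set|exact: prob_gap_le0].
apply/seteqP; split=> o.
  move=> H; apply: contrapT => H'; apply: H => k l; rewrite ltNge; apply/negP => kl.
  by apply: H'; exists k => //; exists l.
by move=> [k _ [l _ kl]] /(_ k l); rewrite ltNge => /negP.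
Qed.

(** With mesh [1 / (m + 1)], a ring of index [m] before [t] forces more than [m] rings among [J]
    slots of total length at most [t + 1]; Chebyshev's inequality bounds this. The factor [P G]
    allows summation over disjoint events. *)
Lemma prob_ring_time_le G k m p t : sigma_of rate G ->
  (forall o, G o -> 0 < rate k o <= p) -> 0 <= t -> p * (t + 1) < m.+1%:R ->
  (P (G `&` ([set o | (ring_time (path o) k m <= t)%R] `&` all_positive)) <=
   (p * (t + 1) / (m.+1%:R - p * (t + 1)) ^+ 2)%:E * P G)%E.
Proof.
move=> sG rateG t0 mu_lt.
have [->|/set0P [oG GoG]] := eqVneq G set0; first by rewrite set0I !measure0 mule0.
have p0 : 0 < p by have /andP[] := rateG _ GoG; exact: lt_le_trans.
have mG := sigma_of_measurable sG.
set mu := p * (t + 1) in mu_lt *.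
have mu0 : 0 <= mu by rewrite mulr_ge0 ?ltW // ltr_wpDl.
pose h : R := m.+1%:R^-1.
have h0 : 0 < h by rewrite invr_gt0.
(* The [m] extra slots pay for the rounding in [matches_lower]. *)
pose J := (m + (Num.truncn (t / h)).+1)%N.
have tJ : t < (Num.truncn (t / h)).+1%:R * h.
  by rewrite -ltr_pdivrMr // truncnS_gt.
have Jt : J%:R * h <= t + 1.
  rewrite /J natrD mulrDl -natr1 mulrDl mul1r.
  have : (Num.truncn (t / h))%:R * h <= t.
    by rewrite -ler_pdivlMr // truncn_le divr_ge0 // ltW.
  have : m%:R * h + h = 1 by rewrite -{2}[h]mul1r -mulrDl natr1 /h divff.
  by lra.
have := @prob_words_le _ _ _ _ _ _ clocks G
   ([set o | ring_time (path o) k m <= t] `&` all_positive) h [:: k] (fun=> J)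
   (fun ws => (m < count id (head [::] ws))%N) (fun=> mu / (m.+1%:R - mu) ^+ 2) sG h0 isT.
rewrite integral_cst //; apply.
- by move=> o Go j; rewrite inE => /eqP ->; have /andP[] := rateG _ Go.
- apply: measurableI; last exact: measurable_all_positive.
  apply: measurable_set_le => //.
  by apply: (@measurable_ring_time _ _ _ (fun k l => gap k l)) => i j.
- by [].
- move=> o [/= Tt pos].
  have [|v sv mv] := @exists_matches R h J 0%N (fun l => gap k l o) (pos k).
    by rewrite mul0r.
  exists [:: v]; split; first by rewrite /= sv.
    by move=> j; rewrite inE => /eqP ->; rewrite /word_of /= eqxx.
  rewrite /= ltnNge; apply/negP => cm.
  have := @matches_lower R h h0 v 0%N (fun l => gap k l o) J m
     (fun l => ltW (pos k l)) mv.
  rewrite -{1 2}sv leqnn take_size => /(_ isT cm).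
  apply/negP; rewrite -ltNge (le_lt_trans Tt) // add0n /J natrD.
  by rewrite addrAC subrr add0r.
move=> o Go /=.
have /andP[r0 rp] := rateG _ Go.
have s01 := slot_prob_ge0 (ltW h0) (ltW r0).
set be := slot_prob h _ in s01 *.
have Jb : J%:R * be <= mu.
  apply: (@le_trans _ _ (J%:R * (p * h))); last by rewrite mulrCA ler_wpM2l // ltW.
  rewrite ler_wpM2l // (@le_trans _ _ (rate k o * h)) ?ler_wpM2r ?(ltW h0) //.
  by rewrite /be /slot_prob; have := expR_ge1Dx (- (rate k o * h)); lra.
apply: le_trans (@word_mean_count_ge R be J m.+1 s01 (le_lt_trans Jb mu_lt)) _.
have /andP[b0 _] := s01.
have d1 : 0 < m.+1%:R - mu by rewrite subr_gt0.
have d2 : 0 < m.+1%:R - J%:R * be by lra.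
apply: ler_pM => //; first by rewrite mulr_ge0.
  by rewrite invr_ge0 exprn_ge0 // ltW.
rewrite lef_pV2 ?posrE ?exprn_gt0 //; rewrite lerXn2r ?nnegrE ?(ltW d1) ?(ltW d2) //.
by rewrite lerD2l lerN2.
Qed.

End RingTimes.

(** * The upper bound *)

Section AlmostSure.
Context d (Omega : measurableType d) (R : realType) (P : probability Omega R).

Lemma le_prob_modulo (A B N : set Omega) : measurable A -> measurable B -> measurable N ->
  P (~` N) = 0%E -> A `&` N `<=` B -> (P A <= P B)%E.
Proof.
move=> mA mB mN N0 AB; have mNC := measurableC mN.
apply: (@le_trans _ _ (P (B `|` ~` N))); last by rewrite measureU0.
apply: le_measure; rewrite ?inE //; first exact: measurableU.
move=> o Ao; have [No|No] := pselect (N o); [left; exact: AB|by right].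
Qed.

Context (rate : nat -> {RV P >-> R}) (gap : nat -> nat -> {RV P >-> R}).
Context (clocks : poisson_clocks_given rate gap).
Context (rate_pos : forall k, P [set o | rate k o <= 0] = 0%E).
Context (rate_le1 : forall k, P [set o | 1 < rate k o] = 0%E).
Local Notation path o := (fun k l => gap k l o).

Definition regular : set Omega := [set o |
  [/\ forall k l, 0 < gap k l o,
      forall k s, exists M, s < ring_time (path o) k M &
      forall k, 0 < rate k o <= 1]].

Lemma sigma_of_rate_itv k (x y : R) : sigma_of rate [set o | x < rate k o <= y].
Proof.
rewrite (_ : mkset _ = [set o | x < rate k o] `&` [set o | rate k o <= y]).
  by apply: sigma_of_setI; [exact: sigma_of_gt|exact: sigma_of_le].
by apply/seteqP; split=> o /=; [move=> /andP[]|move=> [-> ->]].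
Qed.

Let measurable_rate_itv k (x y : R) : measurable [set o | x < rate k o <= y].
Proof. exact: (sigma_of_measurable (sigma_of_rate_itv k x y)). Qed.

Let prob_rate_itv k : P (~` [set o | 0 < rate k o <= 1]) = 0%E.
Proof.
apply/negligibleP; first exact/measurableC/measurable_rate_itv.
rewrite (_ : ~` _ = [set o | rate k o <= 0] `|` [set o | 1 < rate k o]).
  apply: negligibleU; apply/negligibleP.
  - exact: measurable_le_set.
  - exact: rate_pos.
  - exact: measurable_gt_set.
  - exact: rate_le1.
apply/seteqP; split=> o /=.
  by move=> /negP; rewrite negb_and -leNgt -ltNge => /orP.
by move=> H /andP[]; case: H => [/le_lt_trans h /h|/lt_le_trans h _ /h]; rewrite ltxx.
Qed.

Let late k n m : set Omega := [set o | ring_time (path o) k m <= n%:R].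

Let measurable_late k n m : measurable (late k n m).
Proof.
apply: measurable_set_le => //.
by apply: (@measurable_ring_time _ _ _ (fun k l => gap k l)) => i j.
Qed.

Let prob_late k n : P (\bigcap_m late k n m) = 0%E.
Proof.
have mAP := measurable_all_positive gap.
have mB : measurable (\bigcap_m late k n m) by exact: bigcapT_measurable.
apply/eqP; rewrite eq_le measure_ge0 andbT; apply/lee_addgt0Pr => e e0; rewrite add0e.
pose mu : R := 1 * (n%:R + 1).
have mu0 : 0 <= mu by rewrite /mu mul1r addr_ge0.
(* Makes [m.+1 - mu] at least one and at least [mu / e], so that the Chebyshev bound is at most
   [e]. *)
pose m := Num.truncn (mu + 1 + mu / e).
have mlt : mu + 1 + mu / e < m.+1%:R by exact: truncnS_gt.
have mue : 0 <= mu / e by rewrite divr_ge0 // ltW.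
have mum : mu < m.+1%:R by lra.
pose G := [set o | 0 < rate k o <= 1].
have mN : measurable (G `&` all_positive gap) by apply: measurableI => //; exact: measurable_rate_itv.
have N0 : P (~` (G `&` all_positive gap)) = 0%E.
  rewrite setCI measureU0; first exact: prob_rate_itv.
  - exact/measurableC/measurable_rate_itv.
  - exact: measurableC.
  exact: (prob_not_all_positive clocks rate_pos).
have mT : measurable (G `&` (late k n m `&` all_positive gap)).
  by apply: measurableI; [exact: measurable_rate_itv|apply: measurableI].
apply: (le_trans (le_prob_modulo mB mT mN N0 _)).
  by move=> o [Ho [Go APo]]; split=> //; split=> //; exact: Ho.
apply: le_trans (prob_ring_time_le clocks (sigma_of_rate_itv k 0 1) _ _ mum) _ => //.
apply: (@le_trans _ _ ((mu / (m.+1%:R - mu) ^+ 2)%:E * 1)%E).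
  by apply: lee_wpmul2l; [rewrite lee_fin divr_ge0 ?sqr_ge0|exact: probability_le1].
rewrite mule1 lee_fin; have d1 : 1 <= m.+1%:R - mu by lra.
rewrite ler_pdivrMr ?exprn_gt0 //; last by lra.
have : mu <= e * (m.+1%:R - mu).
  by rewrite mulrC -ler_pdivrMr //; lra.
move=> h; apply: (le_trans h); rewrite ler_wpM2l ?(ltW e0) //.
by rewrite expr2 ler_peMr //; lra.
Qed.

Let regularE : regular = all_positive gap `&`
  (\bigcap_k [set o | 0 < rate k o <= 1] `&` \bigcap_k \bigcap_n ~` \bigcap_m late k n m).
Proof.
apply/seteqP; split=> o.
  move=> [g0 unb r01]; split=> //; split; first by move=> k _; exact: r01.
  move=> k _ n _ H; have [M] := unb k n%:R; rewrite ltNge => /negP; apply.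
  exact: (H M I).
move=> [g0 [r01 unb]]; split=> // [k s|k]; last exact: (r01 k I).
apply: contrapT => H; apply: (unb k I (Num.truncn s).+1 I) => m _ /=.
rewrite /late /= leNgt; apply/negP => sm; apply: H; exists m; apply: lt_trans sm.
exact: truncnS_gt.
Qed.

Lemma measurable_regular : measurable regular.
Proof.
rewrite regularE; apply: measurableI; first exact: measurable_all_positive.
apply: measurableI; first by apply: bigcapT_measurable => k; exact: measurable_rate_itv.
apply: bigcapT_measurable => k; apply: bigcapT_measurable => n; apply: measurableC.
exact: bigcapT_measurable.
Qed.

Lemma prob_not_regular : P (~` regular) = 0%E.
Proof.
apply/negligibleP; first exact/measurableC/measurable_regular.
rewrite regularE !setCI; apply: negligibleU.
  apply/negligibleP; first exact/measurableC/measurable_all_positive.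
  exact: (prob_not_all_positive clocks rate_pos).
apply: negligibleU; rewrite setC_bigcap; apply: negligible_bigcup => k.
  by apply/negligibleP; [exact: measurableC|exact: prob_rate_itv].
rewrite setC_bigcap; apply: negligible_bigcup => n; rewrite setCK.
by apply/negligibleP; [exact: bigcapT_measurable|exact: prob_late].
Qed.

End AlmostSure.

Section Slope.
Context (R : realType) (F : R -> R) (c kappa : R).

Lemma slope_bounds : 0 < kappa -> F p / (p - c) @[p --> c^'+] --> kappa ->
  exists2 x0 : R, 0 < x0 & forall x, 0 < x -> x < x0 ->
    kappa / 2 * x <= F (c + x) <= 2 * kappa * x.
Proof.
move=> k0 /cvgrPdist_lt /(_ (kappa / 2)) /(_ _) []; first by rewrite divr_gt0.
move=> x0 /= x00 H; exists x0 => // x xp xx0.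
have := H (c + x); rewrite /ball /= opprD addrA subrr add0r normrN gtr0_norm //.
rewrite ltrDl => /(_ xx0 xp); rewrite [c + x - c]addrC addKr.
rewrite ltr_norml => /andP[h1 h2]; apply/andP; split.
  by rewrite -ler_pdivlMr //; lra.
by rewrite -ler_pdivrMr //; lra.
Qed.

End Slope.

(** * The tail above [b * sqrt t] *)

Section UpperTail.
Context d (Omega : measurableType d) (R : realType) (P : probability Omega R).
Context (rate : nat -> {RV P >-> R}) (gap : nat -> nat -> {RV P >-> R}).
Context (clocks : poisson_clocks_given rate gap).
Context (F : R -> R) (rate_iid : iid_with_cdf rate F).
Context (rate_pos : forall k, P [set o | rate k o <= 0] = 0%E).
Context (rate_le1 : forall k, P [set o | 1 < rate k o] = 0%E).
Local Notation path o := (fun k l => gap k l o).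

Lemma prob_rate_le k x : P [set o | rate k o <= x] = (F x)%:E.
Proof.
by rewrite -(rate_iid.1 k x).
Qed.

Lemma prob_all_rates_gt n y : P [set o | forall i, (i < n)%N -> y < rate i o] = ((1 - F y) ^+ n)%:E.
Proof.
pose J := [fset k in iota 0 n]%fset.
have mgt : measurable [set x : R | y < x].
  by rewrite (_ : mkset _ = `]y, +oo[%classic) //; apply/seteqP; split=> z /=; rewrite in_itv /= andbT.
have := rate_iid.2 J (fun=> [set x | y < x]) (fun _ => mgt).
rewrite (_ : \bigcap_(k in _) _ = [set o | forall i, (i < n)%N -> y < rate i o]); last first.
  apply/seteqP; split=> o H.
    by move=> i iltn; apply: H; rewrite /= in_fset mem_iota.
  by move=> i /=; rewrite in_fset mem_iota => /H.
move=> ->.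
have pJ : perm_eq (enum_fset J) (iota 0 n).
  by apply: uniq_perm => //; [exact: iota_uniq|move=> x; rewrite in_fset].
rewrite (perm_big _ pJ) /= (eq_bigr (fun=> (1 - F y)%:E)); last first.
  move=> k _; rewrite EFinB -(prob_rate_le k) -probability_setC; last exact: measurable_le_set.
  by congr (P _); apply/seteqP; split=> o /=; rewrite ltNge => /negP.
by rewrite prodEFin big_const_seq count_predT size_iota iter_mulr_1.
Qed.

Lemma sigma_of_bigsetU (A : nat -> set Omega) n : (forall i, sigma_of rate (A i)) ->
  sigma_of rate (\big[setU/set0]_(i < n) A i).
Proof.
move=> sA; elim: n => [|n IH]; first by rewrite big_ord0; exact: sigma_algebra0.
rewrite big_ord_recr /= -[X in sigma_of _ X]setCK setCU.
by apply: sigma_algebraC; apply: sigma_of_setI; apply: sigma_algebraC => //; exact: sA.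
Qed.

Lemma sigma_of_seqDU (A : nat -> set Omega) j : (forall i, sigma_of rate (A i)) ->
  sigma_of rate (seqDU A j).
Proof.
move=> sA; rewrite /seqDU setDE; apply: sigma_of_setI => //.
by apply: sigma_algebraC; exact: sigma_of_bigsetU.
Qed.

(* The events "[j] is the first particle of rate at most [p]" are disjoint, so
   no factor [n] is lost. *)
Lemma prob_slow_ring_time_le n m p t : 0 <= t -> p * (t + 1) < m.+1%:R -> 0 <= p ->
  (P (\big[setU/set0]_(j < n) (seqDU (fun j => [set o | (0 < rate j o <= p)%R]) j `&`
      ([set o | (ring_time (path o) j m <= t)%R] `&` all_positive gap))) <=
   (p * (t + 1) / (m.+1%:R - p * (t + 1)) ^+ 2)%:E)%E.
Proof.
move=> t0 mu_lt p0.
pose A j : set Omega := [set o | 0 < rate j o <= p].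
pose S j : set Omega := [set o | (ring_time (path o) j m <= t)%R] `&` all_positive gap.
set B := _ / _.
have sA j : sigma_of rate (A j) by exact: sigma_of_rate_itv.
have sD j : sigma_of rate (seqDU A j) by exact: sigma_of_seqDU.
have mD j : measurable (seqDU A j) by exact: (sigma_of_measurable (sD j)).
have mS j : measurable (S j).
  apply: measurableI; last exact: measurable_all_positive.
  apply: measurable_set_le => //.
  by apply: (@measurable_ring_time _ _ _ (fun k l => gap k l)) => i l.
have B0 : 0 <= B.
  by rewrite divr_ge0 ?sqr_ge0 // mulr_ge0 // addr_ge0.
rewrite -(big_mkord xpredT (fun j => seqDU A j `&` S j)).
apply: (le_trans (le_measure_bigsetU P (index_iota 0 n) xpredT (A := fun j => seqDU A j `&` S j) _)).
  by move=> j; exact: measurableI.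
apply: (@le_trans _ _ (B%:E * \sum_(0 <= j < n) P (seqDU A j))%E).
  rewrite ge0_sume_distrr //; apply: lee_sum => j _.
  by apply: (prob_ring_time_le clocks (sD j)) => // o [].
rewrite big_mkord -(@measure_semi_additive_ord_I _ _ _ P (seqDU A)) //; last 2 first.
- exact: sub_trivIset (trivIset_seqDU A).
- exact: bigsetU_measurable.
rewrite -[leRHS]mule1 lee_wpmul2l // ?lee_fin //.
by apply: probability_le1; exact: bigsetU_measurable.
Qed.

Lemma upper_tail c kappa e : 0 < c -> c <= 1 -> 0 < kappa -> 0 < e ->
  (exists2 x0 : R, 0 < x0 & forall x, 0 < x -> x < x0 -> kappa / 2 * x <= F (c + x)) ->
  exists b0 : R, forall b : R, b0 <= b -> exists t0 : R, forall t : R, t0 <= t ->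
  (P [set o | (b * Num.sqrt t)%:E < num_beyond (path o) c t] <= e%:E)%E.
Proof.
move=> c0 c1 k0 e0 [x0 x00 slope].
(* The [5] gives [1 <= b - 4]; [8 / e] makes the Chebyshev bound [4 / (b - 4) ^+ 2] at most [e / 2];
   [4 / (kappa * e)] does the same for the probability that all the first rates are above [p]. *)
exists (5 + 8 / e + 4 / (kappa * e)) => b b_ge.
have b5 : 5 <= b.
  apply: le_trans b_ge; rewrite -addrA lerDl addr_ge0 // divr_ge0 ?mulr_ge0 ?ltW //.
(* Ensures [1 / sqrt t < x0], where the slope bound holds. *)
exists (1 + x0^-1 ^+ 2) => t t_ge.
have t1 : 1 <= t by apply: le_trans t_ge; rewrite lerDl sqr_ge0.
have t0 : 0 < t by exact: lt_le_trans t1.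
set s := Num.sqrt t.
have ss : s * s = t by rewrite -expr2 sqr_sqrtr // ltW.
have s1 : 1 <= s by rewrite -[leLHS]sqrtr1; exact: ler_wsqrtr.
have s0 : 0 < s by exact: lt_le_trans s1.
pose x := s^-1.
have x_gt0 : 0 < x by rewrite invr_gt0.
have xx0 : x < x0.
  rewrite -[ltRHS]invrK ltf_pV2 ?posrE ?invr_gt0 //.
  rewrite -(@ltr_pXn2r _ 2) ?nnegrE ?invr_ge0 ?(ltW x00) ?(ltW s0) //.
  by rewrite [ltRHS]expr2 ss; apply: lt_le_trans t_ge; rewrite ltrDr.
pose K := Num.truncn (b * s).
have bs0 : 0 <= b * s by rewrite mulr_ge0 ?ltW //; lra.
have Kle : K%:R <= b * s by rewrite truncn_le.
have ltK : b * s < K.+1%:R by exact: truncnS_gt.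
(* If some clock [j <= K] has at most [m] rings by time [t], every particle of index at least [K] is
   at most at the site [truncn (c * t)]. *)
pose m := (Num.truncn (c * t) + K)%N.
have ct0 : 0 <= c * t by rewrite mulr_ge0 ?ltW.
have mle : (Num.truncn (c * t))%:R <= c * t by rewrite truncn_le.
have ltm : c * t < (Num.truncn (c * t)).+1%:R by exact: truncnS_gt.
set p := c + x; have p0 : 0 <= p by rewrite addr_ge0 ?ltW.
have mu_le : p * (t + 1) <= c * t + 3 * s.
  have xs : x * s = 1 by rewrite mulVf ?gt_eqF.
  have xt : x * t = s by rewrite -ss mulrA xs mul1r.
  have x1 : x <= 1 by rewrite -xs ler_peMr // ltW.
  have -> : p * (t + 1) = c * t + x * t + c + x by rewrite /p; ring.
  by rewrite xt; lra.
have m_ge : c * t + b * s - 1 <= m.+1%:R.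
  by rewrite /m -addSn natrD; rewrite -natr1 in ltK; lra.
have d_ge : (b - 4) * s <= m.+1%:R - p * (t + 1).
  have -> : (b - 4) * s = b * s - 4 * s by ring.
  by lra.
have d_gt0 : 0 < m.+1%:R - p * (t + 1).
  by apply: lt_le_trans d_ge; rewrite mulr_gt0 //; lra.
pose slow j := seqDU (fun j => [set o | (0 < rate j o <= p)%R]) j `&`
      ([set o | (ring_time (path o) j m <= t)%R] `&` all_positive gap).
pose fast := [set o | forall i, (i < K.+1)%N -> p < rate i o].
have mfast : measurable fast.
  rewrite (_ : fast = \bigcap_i (if (i < K.+1)%N then [set o | p < rate i o] else setT)).
    by apply: bigcapT_measurable => i; case: ifP => _ //; exact: measurable_gt_set.
  apply/seteqP; split=> o; first by move=> H i _; case: ifPn => // /H.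
  by move=> H i iK; have := H i I; rewrite iK.
have mslow j : measurable (slow j).
  apply: measurableI.
    apply: (@sigma_of_measurable _ _ _ _ rate); apply: sigma_of_seqDU => i.
    exact: sigma_of_rate_itv.
  apply: measurableI; last exact: measurable_all_positive.
  apply: measurable_set_le => //.
  by apply: (@measurable_ring_time _ _ _ (fun k l => gap k l)) => i l.
have mU : measurable (\big[setU/set0]_(j < K.+1) slow j) by exact: bigsetU_measurable.
apply: (@le_trans _ _ (P (\big[setU/set0]_(j < K.+1) slow j `|` fast))).
  apply: (le_prob_modulo _ _ (measurable_regular rate gap)
    (prob_not_regular clocks rate_pos rate_le1)).
  - have mN := @measurable_num_beyond _ _ _ (fun k l => gap k l) (fun _ _ => measurable_funP _) c t.
    by have := emeasurable_fun_o_infty measurableT mN (b * s)%:E; rewrite setTI.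
  - exact: measurableU.
  move=> o [/= /num_beyond_gt[bs_lt0|[k bk ctk]] [gap0 unb r01]].
    by move: bs_lt0; rewrite ltNge bs0.
  have Kk : (K <= k)%N by rewrite -ltnS -(ltr_nat R) (le_lt_trans Kle).
  have [H|/existsNP[i /not_implyP[iK /negP rip]]] := pselect (fast o); [by right|left].
  rewrite -leNgt in rip.
  have ex : exists i, (i < K.+1)%N && (rate i o <= p) by exists i; rewrite iK.
  rewrite -(bigcup_mkord K.+1 slow).
  (* The least index of a slow rate selects one of the disjoint events. *)
  case: (ex_minnP ex) => j /andP[jK rjp] jmin; exists j => //=; split.
    split; first by rewrite /=; have /andP[-> _] := r01 j.
    rewrite -(bigcup_mkord j (fun j => [set o | (0 < rate j o <= p)%R])) => -[l /= lj /andP[_ rlp]].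
    by have := jmin l; rewrite rlp (ltn_trans lj jK) => /(_ isT); rewrite leqNgt lj.
  split; last exact: gap0.
  rewrite /= leNgt; apply/negP => tT.
  have jk : (j <= k)%N by rewrite (leq_trans _ Kk).
  have := xi_le_of_ring_time gap0 unb jk tT.
  have := ctk; rewrite ltNge => /negP H1 H2; apply: H1.
  apply: le_trans mle; rewrite -[leRHS]/((Posz (Num.truncn (c * t)))%:~R) ler_int.
  by apply: le_trans H2 _; rewrite lerBlDr -PoszD lez_nat leq_add2l.
have mu_lt : p * (t + 1) < m.+1%:R by rewrite -subr_gt0.
apply: (le_trans (measureU2 P mU mfast)).
apply: (@le_trans _ _ ((e / 2)%:E + (e / 2)%:E)%E); last by rewrite -EFinD lee_fin; lra.
have b4 : 0 < b - 4 by lra.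
apply: leeD.
  apply: (le_trans (prob_slow_ring_time_le _ (ltW t0) mu_lt p0)); rewrite lee_fin.
  have mu4 : p * (t + 1) <= 4 * (s * s).
    have : s <= s * s by rewrite ler_peMl // ltW.
    have : c * t <= s * s by rewrite ss ler_piMl // ltW.
    by lra.
  apply: (@le_trans _ _ (4 * (s * s) / ((b - 4) * s) ^+ 2)).
    apply: ler_pM => //; first by rewrite mulr_ge0 // addr_ge0 // ltW.
      by rewrite invr_ge0 sqr_ge0.
    rewrite lef_pV2 ?posrE ?exprn_gt0 ?mulr_gt0 //.
    by rewrite lerXn2r ?nnegrE ?(ltW d_gt0) ?mulr_ge0 ?(ltW b4) ?(ltW s0).
  have -> : 4 * (s * s) / ((b - 4) * s) ^+ 2 = 4 / (b - 4) ^+ 2.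
    by field; rewrite !gt_eqF.
  rewrite ler_pdivrMr ?exprn_gt0 //.
  have h : 8 / e <= b - 4.
    have : 0 <= 4 / (kappa * e) by rewrite divr_ge0 ?mulr_ge0 ?ltW.
    by lra.
  have : 8 <= (b - 4) * e by rewrite -ler_pdivrMr.
  have : b - 4 <= (b - 4) ^+ 2 by rewrite expr2 ler_peMl //; lra.
  by move=> h1 h2; have := ler_wpM2r (ltW e0) h1; lra.
apply: (@le_trans _ _ ((1 - F p) ^+ K.+1)%:E); first by rewrite -prob_all_rates_gt lexx.
rewrite lee_fin.
have /(_ x_gt0 xx0) := slope x; rewrite -/p => Fp.
have y0 : 0 <= kappa / 2 * x by rewrite mulr_ge0 ?divr_ge0 ?ltW.
have F1 : F p <= 1 by rewrite -lee_fin -(prob_rate_le 0) probability_le1 //; exact: measurable_le_set.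
apply: (@le_trans _ _ (expR (- (kappa / 2 * x)) ^+ K.+1)).
  rewrite lerXn2r ?nnegrE ?expR_ge0 ?subr_ge0 //.
  by have := expR_ge1Dx (- (kappa / 2 * x)); lra.
rewrite -expRM_natl mulrN expRN -[leRHS]invrK lef_pV2 ?posrE ?expR_gt0 ?invr_gt0 ?divr_gt0 //.
apply: le_trans (expR_ge1Dx _).
have key : b * (kappa / 2) <= K.+1%:R * (kappa / 2 * x).
  have -> : b * (kappa / 2) = b * s * (kappa / 2 * x).
    by rewrite /x; field; rewrite gt_eqF.
  by rewrite ler_wpM2r // ltW.
have e8 : 0 <= 8 / e by rewrite divr_ge0 ?ltW.
have : 4 / (kappa * e) <= b by lra.
rewrite ler_pdivrMr ?mulr_gt0 // => hb.
rewrite invf_div ler_pdivrMr //; nra.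
Qed.

End UpperTail.

(** * The lower bound *)

Section Shift.
Context (R : realType).

Fixpoint shift_words (M i : nat) (ws : seq (seq bool)) : seq (seq bool) :=
  if ws is v :: ws' then drop (i * M) v :: shift_words M i.+1 ws' else [::].

(** The dropped slots are independent of the kept ones, so the lag leaves Bernoulli words of the
    common length [n]. *)
Lemma words_mean_shift M n (be : nat -> R) i m (f : seq (seq bool) -> R) :
  words_mean [seq ((j * M + n)%N, be j) | j <- iota i m] (fun ws => f (shift_words M i ws)) =
  words_mean [seq (n, be j) | j <- iota i m] f.
Proof.
elim: m i f => [|m IH] i f //=.
rewrite -[RHS](word_mean_drop (be i) (i * M) n); apply: eq_word_mean => v _.
exact: (IH i.+1 (fun ws => f (drop (i * M) v :: ws))).
Qed.

Lemma shift_words_rcons M i ws v :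
  shift_words M i (rcons ws v) = rcons (shift_words M i ws) (drop ((i + size ws) * M) v).
Proof. by elim: ws i => [|u ws IH] i /=; rewrite ?addn0 // IH addSnnS. Qed.

Lemma discrete_dep_shift M (w : nat -> seq bool) v ws : w 0%N = v ->
  (forall j, (j < size ws)%N -> w j.+1 = nth [::] ws j) ->
  discrete_dep M w (size ws) = empty_tandem (head [::] (shift_words M 0 (v :: ws)))
     (behead (shift_words M 0 (v :: ws))).
Proof.
rewrite /= mul0n drop0 => w0; elim/last_ind: ws => [|ws u IH] H.
  by rewrite /= w0 mul0n drop0.
rewrite shift_words_rcons /empty_tandem foldl_rcons -/(empty_tandem _ _) -IH.
  rewrite size_rcons /=; congr (departures _ _ _); rewrite add1n; congr drop.
  by rewrite H ?size_rcons // nth_rcons ltnn eqxx.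
move=> j jws; rewrite H ?size_rcons; last exact: ltnW.
by rewrite nth_rcons jws.
Qed.

End Shift.

(** * Estimates uniform in the mesh and choice of the parameters *)

Section SlotEstimates.
Context (R : realType).
Implicit Types (h p lam z : R).

Lemma one_minus_expR_ge z : 0 <= z -> z / (1 + z) <= 1 - expR (- z).
Proof.
move=> z0; have z1 : 0 < 1 + z by rewrite ltr_wpDr.
have : expR (- z) <= (1 + z)^-1.
  by rewrite expRN lef_pV2 ?posrE ?expR_gt0 // expR_ge1Dx.
have -> : z / (1 + z) = 1 - (1 + z)^-1 by field; rewrite gt_eqF.
by lra.
Qed.

Lemma slot_prob_le h p : slot_prob h p <= p * h.
Proof. by rewrite /slot_prob; have := expR_ge1Dx (- (p * h)); lra. Qed.

Lemma slot_prob_ge h p : 0 <= p -> 0 <= h -> p * h * (1 - p * h) <= slot_prob h p.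
Proof.
move=> p0 h0; have z0 : 0 <= p * h by exact: mulr_ge0.
apply: le_trans (one_minus_expR_ge z0); rewrite ler_wpM2l //.
by rewrite -[leRHS]mul1r ler_pdivlMr ?ltr_wpDr //; have := sqr_ge0 (p * h); rewrite expr2; lra.
Qed.

Lemma slot_prob_lt h p lam : 0 < h -> lam < p -> slot_prob h lam < slot_prob h p < 1.
Proof.
move=> h0 lp; rewrite /slot_prob gtrBl expR_gt0 andbT.
by rewrite ltrD2l ltrN2 ltr_expR ltrN2 ltr_pM2r.
Qed.

(** The mesh cancels: the difference of slot probabilities factors as
    [(1 - slot_prob h lam) * (1 - expR (- z))] with [z = (p - lam) * h], which leaves
    [slot_prob h lam <= h] over at least [z / 2]. *)
Lemma slot_queue_mean_le h p lam : 0 < h -> 0 < lam -> lam < p -> lam <= 1 -> (p - lam) * h <= 1 ->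
  slot_prob h lam * (1 - slot_prob h lam) / (slot_prob h p - slot_prob h lam) <= 2 / (p - lam).
Proof.
move=> h0 lam0 lp lam1 z1.
set z := (p - lam) * h in z1.
have pl0 : 0 < p - lam by rewrite subr_gt0.
have z0 : 0 < z by rewrite mulr_gt0.
have qz : z / 2 <= 1 - expR (- z).
  apply: le_trans (one_minus_expR_ge (ltW z0)); rewrite ler_wpM2l ?(ltW z0) //.
  by rewrite lef_pV2 ?posrE //; lra.
have q0 : 0 < 1 - expR (- z) by apply: lt_le_trans qz; rewrite divr_gt0.
have -> : slot_prob h p - slot_prob h lam = (1 - slot_prob h lam) * (1 - expR (- z)).
  rewrite /slot_prob; have -> : expR (- (p * h)) = expR (- (lam * h)) * expR (- z).
    by rewrite -expRD; congr expR; rewrite /z; ring.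
  by ring.
have n0 : 1 - slot_prob h lam != 0 by rewrite /slot_prob subKr gt_eqF ?expR_gt0.
have -> : slot_prob h lam * (1 - slot_prob h lam) / ((1 - slot_prob h lam) * (1 - expR (- z)))
   = slot_prob h lam / (1 - expR (- z)) by field; rewrite n0 gt_eqF.
rewrite ler_pdivrMr //; apply: (@le_trans _ _ (2 / (p - lam) * (z / 2))).
  have -> : 2 / (p - lam) * (z / 2) = h by rewrite /z; field; rewrite gt_eqF.
  by apply: le_trans (slot_prob_le _ _) _; rewrite ler_piMl // ltW.
by rewrite ler_wpM2l // divr_ge0 // ltW.
Qed.

(** Meant for the excess [x] of a rate over [c]. The event [x <= y] has probability of order [y], so
    with one-sided indicators every dyadic scale contributes a bounded mean, whatever the size of
    [del]. *)
Lemma dyadic_bound (x del : R) L : 0 < del -> 2 * del < x -> x <= 2 ^+ L.+1 * del ->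
  x^-1 <= \sum_(j < L) (2 ^+ j.+1 * del)^-1 * (x <= 2 ^+ j.+2 * del)%R%:R.
Proof.
move=> d0 xgt; have x0 : 0 < x by apply: lt_trans xgt; rewrite mulr_gt0.
have t0 j : 0 <= (2 ^+ j.+1 * del)^-1 * (x <= 2 ^+ j.+2 * del)%R%:R.
  by rewrite mulr_ge0 // invr_ge0 mulr_ge0 ?exprn_ge0 ?ltW.
elim: L => [|L IH] xle; first by move: xgt; rewrite ltNge -[2 in X in X * _]expr1 xle.
rewrite big_ord_recr /=; have [/IH xL|xL] := leP x (2 ^+ L.+1 * del).
  by rewrite -[leLHS]addr0 lerD.
rewrite xle mulr1 -[leLHS]add0r lerD ?sumr_ge0 //.
by rewrite lef_pV2 ?posrE ?mulr_gt0 ?exprn_gt0 // ltW.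
Qed.

(* [del] is chosen so that, with probability at least [1 - e / 8], none of the
   first [k] rates is below [c + 2 * del]; [L] is the number of dyadic scales
   between [del] and [1]. *)
Lemma lower_parameters (q a e : R) : 0 < q -> 0 < a -> 0 < e ->
  exists t0 : R, forall t, t0 <= t ->
  let s := Num.sqrt t in let k := (Num.truncn (a * s / ln t)).+1 in
  let del := e / (16 * q * k%:R) in
  exists L : nat, [/\ 1 <= t /\ a * s / ln t <= k%:R, k%:R + 3 <= del * t / 4,
    16 / (del ^+ 2 * t) <= e / 8,
    16 * q * k%:R * L%:R / (del * t) <= e / 8 &
    1 <= 2 ^+ L.+1 * del /\ k%:R / (4 * (t + 1)) <= e / 8].
Proof.
move=> q0 a0 e0.
(* The constant for which [ln t / Q <= del * sqrt t]. *)
pose Q := 32 * q * a / e.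
have Q0 : 0 < Q by rewrite divr_gt0 ?mulr_gt0.
(* Lower bound for [ln t]: the summands serve, in order, [1 <= ln t], the bound on
   [16 / (del ^+ 2 * t)], the bound involving [L], [k + 3 <= del * t / 4], and [k <= sqrt t]. *)
pose lam := 1 + 128 * Q ^+ 2 / e + 32 * Q ^+ 2 + 16 * Q + 2 * a.
(* [16 / a ^+ 2 <= sqrt t] yields [ln t <= a * sqrt t], and [2 / e <= sqrt t] yields the last bound,
   on [k / (4 * (t + 1))]. *)
exists (expR lam + ((16 / a ^+ 2) ^+ 2 + (2 / e) ^+ 2 + 1)) => t t_ge s k del.
have x1 : 0 <= 128 * Q ^+ 2 / e by rewrite divr_ge0 ?(ltW e0) // mulr_ge0 ?sqr_ge0.
have x2 : 0 <= 32 * Q ^+ 2 by rewrite mulr_ge0 ?sqr_ge0.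
have y1 : 0 <= (16 / a ^+ 2) ^+ 2 := sqr_ge0 _.
have y2 : 0 <= (2 / e) ^+ 2 := sqr_ge0 _.
have el0 : 0 < expR lam := expR_gt0 _.
have t1 : 1 <= t by lra.
have t0 : 0 < t by exact: lt_le_trans t1.
pose l := ln t.
have l_ge : lam <= l by rewrite /l -[lam]expRK ler_ln ?posrE //; lra.
have [l1 lQ1 lQ2 lQ3 l2a] : [/\ 1 <= l, 128 * Q ^+ 2 / e <= l, 32 * Q ^+ 2 <= l,
    16 * Q <= l & 2 * a <= l].
  by rewrite /lam in l_ge; split; lra.
have l0 : 0 < l by exact: lt_le_trans l1.
have ss : s * s = t by rewrite -expr2 sqr_sqrtr // ltW.
have s_gt0 : 0 < s by rewrite sqrtr_gt0.
have sge (x : R) : 0 <= x -> x ^+ 2 <= t -> x <= s.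
  by move=> x0 xt; rewrite -[x]ger0_norm // -sqrtr_sqr; exact: ler_wsqrtr.
have s1 : 1 <= s by apply: sge; rewrite ?expr1n.
have s2 : 2 / e <= s by apply: sge; [rewrite divr_ge0 ?ltW|lra].
have s3 : 16 / a ^+ 2 <= s by apply: sge; [rewrite divr_ge0 ?sqr_ge0|lra].
have l_le : l <= a * s.
  (* [ln t = 4 * ln r] with [r] the fourth root of [t], and [ln r <= r]. *)
  pose r := Num.sqrt s.
  have rr : r * r = s by rewrite -expr2 sqr_sqrtr // ltW.
  have r0 : 0 < r by rewrite sqrtr_gt0.
  have lr : l = 4 * ln r.
    by rewrite /l -ss -rr !lnM ?posrE ?mulr_gt0 //; ring.
  have lnr : ln r <= r.
    by have := le_ln1Dx (x := r - 1); rewrite addrCA subrr addr0 => /(_ _); lra.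
  have ra : 4 / a <= r.
    rewrite -(@ler_pXn2r _ 2) ?nnegrE ?divr_ge0 ?(ltW r0) ?(ltW a0) //.
    by rewrite expr_div_n [leRHS]expr2 rr (_ : 4 ^+ 2 = 16) //; ring.
  have : 4 <= r * a by rewrite -ler_pdivrMr.
  by move=> h; rewrite lr -rr; nra.
have k_ge : a * s / l <= k%:R by rewrite /k; apply/ltW/truncnS_gt.
have k_le : k%:R <= 2 * (a * s / l).
  have h1 : 1 <= a * s / l by rewrite ler_pdivlMr // mul1r.
  rewrite /k -natr1.
  have : (Num.truncn (a * s / l))%:R <= a * s / l by rewrite truncn_le; lra.
  by rewrite -/l; lra.
have k0 : 0 < (k%:R : R) by rewrite ltr0n.
clearbody k.
have kl : k%:R * l <= 2 * a * s.
  by move: k_le; rewrite mulrA ler_pdivlMr // mulrA.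
have ks : k%:R <= s.
  have : k%:R * (2 * a) <= 2 * a * s by apply: le_trans kl; rewrite ler_wpM2l // ltW.
  by rewrite [k%:R * _]mulrC ler_pM2l // mulr_gt0.
have d0 : 0 < del by rewrite divr_gt0 ?mulr_gt0.
have ds : l / Q <= del * s.
  have -> : l / Q = (e / (16 * q)) * (l / (2 * a)).
    by rewrite /Q; field; rewrite !gt_eqF ?mulr_gt0.
  have -> : del * s = (e / (16 * q)) * (s / k%:R).
    by rewrite /del; field; rewrite !gt_eqF ?mulr_gt0.
  rewrite ler_wpM2l ?divr_ge0 ?mulr_ge0 ?(ltW e0) ?(ltW q0) //.
  by rewrite ler_pdivrMr ?mulr_gt0 // mulrAC ler_pdivlMr // mulrC [s * _]mulrC.
have dt : del * t = del * s * s by rewrite -mulrA ss.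
have c5 : k%:R + 3 <= del * t / 4.
  have : 16 <= l / Q by rewrite ler_pdivlMr.
  move=> h; have : 16 * s <= del * t by rewrite dt ler_wpM2r ?(ltW s_gt0) // (le_trans h).
  by lra.
(* Between [2 * ln t] and [4 * ln t]: the lower bound gives [t <= 2 ^+ L] because [1 / 2 <= ln 2],
   the upper one keeps the sum over scales small. *)
exists (2 * (Num.truncn l).+1)%N.
have Lle : (2 * (Num.truncn l).+1)%:R <= 4 * l :> R.
  have : (Num.truncn l)%:R <= l by rewrite truncn_le; lra.
  by rewrite natrM -natr1; lra.
have Lge : 2 * l <= (2 * (Num.truncn l).+1)%:R :> R.
  by rewrite natrM ler_wpM2l // ltW // truncnS_gt.
move: Lle Lge; set L := (2 * _)%N; clearbody L => Lle Lge.
split=> //.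
- have dd : 0 < del ^+ 2 * t by apply: mulr_gt0 => //; exact: exprn_gt0.
  rewrite ler_pdivrMr //.
  have -> : del ^+ 2 * t = (del * s) ^+ 2 by rewrite -ss; ring.
  have : (l / Q) ^+ 2 <= (del * s) ^+ 2.
    rewrite lerXn2r ?nnegrE //; first by rewrite divr_ge0 ?ltW.
    by apply: mulr_ge0; exact: ltW.
  move=> h; apply: (@le_trans _ _ (e / 8 * (l / Q) ^+ 2)); last first.
    by rewrite ler_wpM2l // divr_ge0 ?ltW.
  rewrite expr_div_n mulrA ler_pdivlMr ?exprn_gt0 //.
  have : 128 * Q ^+ 2 <= l * e by rewrite -ler_pdivrMr.
  have : l * e <= l ^+ 2 * e by rewrite ler_wpM2r ?(ltW e0) // expr2 ler_peMl // ltW.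
  by lra.
- have -> : 16 * q * k%:R * L%:R / (del * t) = ((16 * q) / e) ^+ 2 * e * (k%:R / s) ^+ 2 * L%:R.
    by rewrite /del -ss; field; rewrite !gt_eqF ?mulr_gt0.
  have kq : k%:R / s <= 2 * a / l by rewrite ler_pdivrMr // mulrAC ler_pdivlMr.
  have kq2 : (k%:R / s) ^+ 2 <= (2 * a / l) ^+ 2.
    rewrite lerXn2r ?nnegrE //; first by rewrite divr_ge0 ?ltW.
    by rewrite divr_ge0 ?(ltW l0) // mulr_ge0 // ltW.
  apply: (@le_trans _ _ ((16 * q / e) ^+ 2 * e * (2 * a / l) ^+ 2 * (4 * l))).
    have qe : 0 <= (16 * q / e) ^+ 2 * e by apply: mulr_ge0 (sqr_ge0 _) (ltW e0).
    apply: ler_pM => //; first by apply: mulr_ge0 qe (sqr_ge0 _).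
    by rewrite ler_wpM2l.
  have -> : (16 * q / e) ^+ 2 * e * (2 * a / l) ^+ 2 * (4 * l) = 4 * e * Q ^+ 2 / l.
    by rewrite /Q; field; rewrite !gt_eqF.
  rewrite ler_pdivrMr //; have := ler_wpM2l (ltW e0) lQ2; lra.
- split.
    have t2L : t <= 2 ^+ L.
      apply: (@le_trans _ _ (expR (2^-1) ^+ L)).
        rewrite -expRM_natl -[t]lnK ?posrE // ler_expR -/l.
        by rewrite ler_pdivlMr // mulrC.
      rewrite lerXn2r ?nnegrE ?expR_ge0 //.
      rewrite -[2^-1]opprK expRN -[leRHS]invrK lef_pV2 ?posrE ?expR_gt0 ?invr_gt0 //.
      by have := expR_ge1Dx (- 2^-1 : R); lra.
    have : t * del <= 2 ^+ L * del by rewrite ler_wpM2r // ltW.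
    have : 0 < t * del by rewrite mulr_gt0.
    by rewrite exprS; lra.
rewrite ler_pdivrMr ?mulr_gt0 ?addr_gt0 //.
have : 2 <= s * e by rewrite -ler_pdivrMr.
move=> h; have : s * 2 <= s * (s * e) by rewrite ler_wpM2l // ltW.
rewrite mulrA ss; lra.
Qed.

End SlotEstimates.

Section SlotTandem.
Context (R : realType).

(** Chebyshev's inequality for the arrivals. Of the loss [3] in the mean, [2] comes from the missing
    time [t - n * h] and [1] from replacing [slot_prob h lam] by [lam * h * (1 - h)]. *)
Lemma count_slots_lt (h lam t x : R) (n : nat) : 0 < h -> h <= 1 -> t * h <= 1 -> 0 < lam -> lam <= 1 ->
  n%:R * h <= t -> t - 2 <= n%:R * h -> 1 <= t -> x < lam * t - 3 ->
  word_mean (slot_prob h lam) n (fun a => ((count id a)%:R < x)%R%:R) <= t / (lam * t - 3 - x) ^+ 2.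
Proof.
move=> h0 h1 th lam0 lam1 nt tn t1 xlt.
have s01 := slot_prob_ge0 (ltW h0) (ltW lam0).
have lh : lam * h <= h by rewrite ler_piMl // ltW.
have mean_le : n%:R * slot_prob h lam <= t.
  apply: le_trans nt; rewrite ler_wpM2l // (le_trans (slot_prob_le _ _)) //.
have mean_ge : lam * t - 3 <= n%:R * slot_prob h lam.
  apply: (@le_trans _ _ (n%:R * (lam * h * (1 - h)))); last first.
    rewrite ler_wpM2l // (le_trans _ (slot_prob_ge (ltW lam0) (ltW h0))) //.
    by rewrite ler_wpM2l ?mulr_ge0 ?(ltW h0) ?(ltW lam0) // lerB.
  have -> : n%:R * (lam * h * (1 - h)) = lam * (n%:R * h * (1 - h)) by ring.
  have : t - 3 <= n%:R * h * (1 - h).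
    have : n%:R * h * h <= t * h by rewrite ler_wpM2r // ltW.
    by lra.
  move=> H; apply: (@le_trans _ _ (lam * (t - 3))); first by lra.
  by rewrite ler_wpM2l // ltW.
apply: le_trans (word_mean_count_lt s01 (lt_le_trans xlt mean_ge)) _.
have d0 : 0 < lam * t - 3 - x by lra.
have d1 : 0 < n%:R * slot_prob h lam - x by lra.
case/andP: s01 => s0 _; apply: ler_pM => //; first by rewrite mulr_ge0.
  by rewrite invr_ge0 sqr_ge0.
by rewrite lef_pV2 ?posrE ?exprn_gt0 // lerXn2r ?nnegrE ?(ltW d0) ?(ltW d1) // lerB.
Qed.

Definition tandem_count (M : nat) (ws : seq (seq bool)) : nat :=
  count id (empty_tandem (head [::] (shift_words M 0 ws)) (behead (shift_words M 0 ws))).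

Lemma slot_tandem_tail (h lam t x y : R) (p : nat -> R) (n M K : nat) :
  0 < h -> h <= 1 -> t * h <= 1 -> 0 < lam ->
  n%:R * h <= t -> t - 2 <= n%:R * h -> 1 <= t -> 0 < y -> x + y < lam * t - 3 ->
  (forall k, (k <= K)%N -> lam < p k <= 1) ->
  words_mean [seq ((j * M + n)%N, slot_prob h (p j)) | j <- iota 0 K.+1]
    (fun ws => ((tandem_count M ws)%:R < x)%R%:R) <=
  t / (lam * t - 3 - (x + y)) ^+ 2 + (\sum_(j <- iota 0 K.+1) 2 / (p j - lam)) / y.
Proof.
move=> h0 h1 th lam0 nt tn t1 y0 xy pK.
have lam1 : lam <= 1.
  by have /andP[h2 h3] := pK 0%N isT; exact/ltW/(lt_le_trans h2).
have pj j : j \in iota 0 K.+1 -> lam < p j <= 1.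
  by rewrite mem_iota add0n ltnS => /pK.
rewrite (words_mean_shift M n (fun j => slot_prob h (p j)) 0 K.+1
  (fun bs => ((count id (empty_tandem (head [::] bs) (behead bs)))%:R < x)%R%:R)).
have al0 : 0 < slot_prob h lam.
  by rewrite /slot_prob subr_gt0 -expR0 ltr_expR oppr_lt0 mulr_gt0.
have := @empty_tandem_tail R (slot_prob h lam) (slot_prob h (p 0%N))
  [seq slot_prob h (p j) | j <- iota 1 K] n x y al0 y0.
rewrite -[_ :: map _ _]/(map (fun j => slot_prob h (p j)) (iota 0 K.+1)) -map_comp big_map.
move=> /(_ _)/le_trans; apply.
  by move=> be /mapP[j /pj /andP[lp p1] ->]; exact: slot_prob_lt.
apply: lerD; first exact: count_slots_lt.
rewrite ler_wpM2r ?invr_ge0 ?(ltW y0) // big_seq [leRHS]big_seq; apply: ler_sum => j.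
move=> /pj /andP[lp p1]; apply: slot_queue_mean_le => //.
by rewrite (le_trans _ h1) // ler_piMl ?(ltW h0) //; lra.
Qed.

End SlotTandem.

Section IntegralIndic.
Context d (Omega : measurableType d) (R : realType) (P : probability Omega R).

(** Averages over the rates a conditional bound of the form produced by [dyadic_bound]: a constant
    plus weighted indicators of small rates. *)
Lemma integral_indic_sum_le (G : set Omega) (A : R) (I : Type) (r : seq I)
    (c b : I -> R) (B : I -> set Omega) :
  measurable G -> (forall i, measurable (B i)) -> 0 <= A -> (forall i, 0 <= c i) ->
  (forall i, (P (B i) <= (b i)%:E)%E) ->
  (\int[P]_(o in G) (A + \sum_(i <- r) c i * \1_(B i) o)%:E <=
   (A + \sum_(i <- r) c i * b i)%:E)%E.
Proof.
move=> mG mB A0 c0 PB.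
have m1 i : measurable_fun G (\1_(B i) : Omega -> R).
  by apply: measurable_funTS; apply/measurable_indicP.
have mS s : measurable_fun G (fun o => A + \sum_(i <- s) c i * \1_(B i) o).
  apply: measurable_funD => //; apply: measurable_sum => i; exact: measurable_funM.
have S0 s o : 0 <= A + \sum_(i <- s) c i * \1_(B i) o.
  by rewrite addr_ge0 // sumr_ge0 // => i _; rewrite mulr_ge0.
elim: r => [|i r IH].
  rewrite big_nil addr0 (eq_integral (cst A%:E)); last by move=> o _; rewrite big_nil addr0.
  rewrite integral_cst // -[leRHS]mule1; apply: lee_wpmul2l; first by rewrite lee_fin.
  exact: probability_le1.
rewrite (eq_integral (fun o => (A + \sum_(i <- r) c i * \1_(B i) o)%:E + (c i * \1_(B i) o)%:E)%E);
  last by move=> o _; rewrite -EFinD big_cons; congr (_%:E); ring.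
have mi : measurable_fun G (fun o => c i * \1_(B i) o).
  exact: measurable_funM.
rewrite ge0_integralD //; first last.
- exact/measurable_EFinP.
- by move=> o _; rewrite lee_fin mulr_ge0.
- exact/measurable_EFinP.
- by move=> o _; rewrite lee_fin.
rewrite big_cons (_ : _ + (_ + _) = (A + \sum_(i <- r) c i * b i) + c i * b i); last by ring.
rewrite EFinD; apply: leeD => //.
under eq_integral do rewrite EFinM.
rewrite ge0_integralZl //; first last.
- by rewrite lee_fin.
- exact/measurable_EFinP.
rewrite integral_indic // EFinM; apply: lee_wpmul2l; first by rewrite lee_fin.
apply: le_trans (PB i); apply: le_measure; rewrite ?inE //; exact: measurableI.
Qed.

End IntegralIndic.

Lemma tandem_count_le_xi (R : realType) (gap : nat -> nat -> R) (h t : R) (K M n : nat)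
    (w : nat -> seq bool) : 0 < h ->
  (forall k l, (k <= K)%N -> 0 < gap k l) ->
  (forall k, (k <= K)%N -> t < ring_time gap k M) ->
  (forall k, (k <= K)%N -> size (w k) = (k * M + n)%N) ->
  (forall k, (k <= K)%N -> matches h 0 (gap k) (w k)) ->
  (K * M + n)%:R * h <= t ->
  (tandem_count M [seq w j | j <- iota 0 K.+1])%:Z <= xi gap K t + K%:Z.
Proof.
move=> h0 g0 late sw mw nt.
have := discrete_dep_le_xi h0 g0 late sw mw (leqnn K) (lexx t) (leqnn _) nt.
rewrite addKn take_oversize ?(size_discrete_dep sw) // /tandem_count.
have := @discrete_dep_shift M w (w 0%N) [seq w j | j <- iota 1 K] erefl.
rewrite size_map size_iota => /(_ _) -> // j jK.
by rewrite (nth_map 0%N) ?size_iota // nth_iota.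
Qed.

(** * The tail below [a * sqrt t / ln t] *)

Section LowerTail.
Context d (Omega : measurableType d) (R : realType) (P : probability Omega R).
Context (rate : nat -> {RV P >-> R}) (gap : nat -> nat -> {RV P >-> R}).
Context (clocks : poisson_clocks_given rate gap).
Context (rate_pos : forall k, P [set o | rate k o <= 0] = 0%E).
Context (rate_le1 : forall k, P [set o | 1 < rate k o] = 0%E).
Local Notation path o := (fun k l => gap k l o).

Lemma prob_bigsetU_le (A : nat -> set Omega) n (x : R) : (forall i, measurable (A i)) ->
  (forall i, (P (A i) <= x%:E)%E) ->
  (P (\big[setU/set0]_(i < n) A i) <= (n%:R * x)%:E)%E.
Proof.
move=> mA Ax; rewrite -(big_mkord xpredT A).
apply: (le_trans (le_measure_bigsetU P (index_iota 0 n) xpredT mA)).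
apply: (@le_trans _ _ (\sum_(0 <= i < n) x%:E)%E); first by apply: lee_sum => i _.
by rewrite big_mkord sumEFin sumr_const card_ord mulr_natl.
Qed.

Lemma sigma_of_all n (A : nat -> set Omega) : (forall i, sigma_of rate (A i)) ->
  sigma_of rate [set o | forall i, (i < n)%N -> A i o].
Proof.
move=> sA; rewrite (_ : mkset _ = ~` \big[setU/set0]_(i < n) ~` A i).
  apply: sigma_algebraC; apply: (@sigma_of_bigsetU _ _ _ _ rate (fun i => ~` A i)) => i.
  by apply: sigma_algebraC; exact: sA.
rewrite -(bigcup_mkord n (fun i => ~` A i)).
apply/seteqP; split=> o.
  by move=> H [i /= iltn]; apply; exact: H.
by move=> H i iltn; apply: contrapT => nA; apply: H; exists i.
Qed.

Definition no_early_ring (K M : nat) (t : R) : set Omega :=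
  [set o | forall k, (k < K.+1)%N -> t < ring_time (path o) k M].

Lemma measurable_ring_time_le k m (t : R) : measurable [set o | ring_time (path o) k m <= t].
Proof.
apply: measurable_set_le => //.
by apply: (@measurable_ring_time _ _ _ (fun k l => gap k l)) => i l.
Qed.

Lemma measurable_no_early_ring K M t : measurable (no_early_ring K M t).
Proof.
rewrite (_ : no_early_ring K M t = \bigcap_k (if (k < K.+1)%N then
   ~` [set o | ring_time (path o) k M <= t] else setT)).
  apply: bigcapT_measurable => k; case: ifP => _ //.
  exact/measurableC/measurable_ring_time_le.
apply/seteqP; split=> o.
  by move=> H k _; case: ifPn => // /H; rewrite ltNge => /negP.
by move=> H k kK; have := H k I; rewrite kK ltNge => /negP.
Qed.

Lemma measurable_xi_le k t (x : R) : measurable [set o | (xi (path o) k t)%:~R <= x].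
Proof.
rewrite (_ : mkset _ = \bigcup_(u : int) ([set o | xi (path o) k t = u] `&`
   (if u%:~R <= x then setT else set0))).
  apply: countable_bigcupT_measurable => // u.
  apply: measurableI; last by case: ifP.
  by apply: (@measurable_xi _ _ _ (fun k l => gap k l)).
apply/seteqP; split=> o; first by move=> /= H; exists (xi (path o) k t) => //; split=> //; rewrite H.
by move=> [u _ [/= ->]]; case: ifP.
Qed.

(* The queues of the stationary tandem hold [O(k log k)] customers in total:
   [2 / (p - lam)] each, summed dyadically over the rates [p]. *)
Lemma prob_lag_le (F : R -> R) (c q e t h : R) (n M K L : nat)
    (del := e / (16 * q * K.+1%:R)) (G := [set o | forall i, (i < K.+1)%N -> c + 2 * del < rate i o <= 1]) :
  (forall k x, P [set o | rate k o <= x] = (F x)%:E) ->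
  0 < c -> 0 < q -> 0 < e -> (forall x, 0 < x -> F (c + x) <= q * x) ->
  0 < h -> h <= 1 -> t * h <= 1 -> (K * M + n)%:R * h <= t -> t - 2 <= n%:R * h -> 1 <= t ->
  K.+1%:R + 3 <= del * t / 4 -> 16 / (del ^+ 2 * t) <= e / 8 ->
  16 * q * K.+1%:R * L%:R / (del * t) <= e / 8 -> 1 <= 2 ^+ L.+1 * del ->
  (P (G `&` ([set o | ((xi (path o) K t)%:~R <= c * t)%R] `&`
      (all_positive gap `&` no_early_ring K M t))) <= (e / 8 + e / 8)%:E)%E.
Proof.
move=> rate_cdf c0 q0 e0 Fq h0 h1 th nt tn t1 c1 c2 c3 c4.
have k0 : 0 < (K.+1%:R : R) by [].
have d0 : 0 < del by rewrite divr_gt0 ?mulr_gt0.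
clearbody del; set k : R := K.+1%:R in k0 c1 c3.
have t0 : 0 < t by exact: lt_le_trans t1.
have dt0 : 0 < del * t by exact: mulr_gt0.
have sG : sigma_of rate G.
  by apply: (@sigma_of_all K.+1 (fun i => [set o | c + 2 * del < rate i o <= 1])) => i; exact: sigma_of_rate_itv.
have mG : measurable G by exact: (sigma_of_measurable sG).
(* Arrivals at rate [lam] exceed [c * t] by [del * t]. Half of this surplus, [z], is granted to the
   initial customers; [x] lies [K.+1] above [c * t] because the number of jumps is the position plus
   [K]. *)
pose lam := c + del.
pose x := c * t + k.
pose z := del * t / 2.
have z0 : 0 < z by rewrite divr_gt0.
pose ks := iota 0 K.+1.
pose r := [seq (i, l) | i <- ks, l <- iota 0 L].
pose B (s : nat * nat) : set Omega := [set o | rate s.1 o <= c + 2 ^+ s.2.+2 * del].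
(* From [2 / (p - lam) <= 4 / (p - c)], valid for a rate [p] with [p - c > 2 * del], divided by [z]
   and split dyadically. *)
pose cf (s : nat * nat) : R := 4 / z * (2 ^+ s.2.+1 * del)^-1.
pose bf (s : nat * nat) : R := q * (2 ^+ s.2.+2 * del).
pose C o := e / 8 + \sum_(s <- r) cf s * \1_(B s) o.
have p2 l : 0 < (2 ^+ l : R) by exact: exprn_gt0.
have mB s : measurable (B s) by exact: measurable_le_set.
have cf0 s : 0 <= cf s by rewrite mulr_ge0 ?divr_ge0 ?invr_ge0 ?(ltW z0) // mulr_ge0 ?ltW.
have PB s : (P (B s) <= (bf s)%:E)%E.
  by rewrite rate_cdf lee_fin Fq // mulr_gt0.
have m1 s : measurable_fun G (\1_(B s) : Omega -> R).
  by apply: measurable_funTS; apply/measurable_indicP.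
have mC : measurable_fun G C.
  by apply: measurable_funD => //; apply: measurable_sum => s; exact: measurable_funM.
have e80 : 0 <= e / 8 by rewrite divr_ge0 ?ltW.
apply: (@le_trans _ _ (\int[P]_(o in G) (C o)%:E)%E); last first.
  apply: (le_trans (integral_indic_sum_le r mG mB e80 cf0 PB)).
  rewrite lee_fin lerD2l; apply: le_trans c3.
  (* Every pair of a particle and a scale contributes [8 * q / z]. *)
  rewrite big_allpairs_dep (eq_bigr (fun=> \sum_(l <- iota 0 L) (8 * q / z))); last first.
    move=> i _; apply: eq_bigr => l _; rewrite /cf /bf /=.
    have -> : 2 ^+ l.+2 = 2 * 2 ^+ l.+1 :> R by rewrite exprS.
    by field; rewrite !gt_eqF.
  rewrite !big_const_seq !count_predT !size_iota !iter_addr_0 -/k.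
  rewrite -[_ *+ L]mulr_natr -[_ *+ K.+1]mulr_natr -/k /z.
  rewrite le_eqVlt; apply/orP; left; apply/eqP; field.
  by rewrite !gt_eqF.
pose Ev := [set o | (xi (path o) K t)%:~R <= c * t] `&`
      (all_positive gap `&` no_early_ring K M t).
have mEv : measurable Ev.
  apply: measurableI; last first.
    by apply: measurableI; [exact: measurable_all_positive|exact: measurable_no_early_ring].
  exact: measurable_xi_le.
apply: (@prob_words_le _ _ _ _ _ _ clocks G Ev h ks (fun j => (j * M + n)%N)
   (fun ws => ((tandem_count M ws)%:R < x)%R) C) => //.
- exact: iota_uniq.
- move=> o Go i; rewrite mem_iota => /Go /andP[ri _].
  by apply: lt_trans ri; rewrite addr_gt0 ?mulr_gt0.
- move=> o [/= xict [gap0 late]].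
  have /choice[w wP] : forall j, exists v, size v = (j * M + n)%N /\
      matches h 0 (fun l => gap j l o) v.
    move=> j; have [|v sv mv] := @exists_matches R h (j * M + n) 0 (fun l => gap j l o) (gap0 j).
      by rewrite mul0r.
    by exists v.
  have word_ofE j : (j < K.+1)%N -> word_of ks [seq w i | i <- ks] j = w j.
    move=> jK; have jks : j \in ks by rewrite mem_iota.
    by rewrite /word_of (nth_map 0%N) ?index_mem // nth_index.
  exists [seq w i | i <- ks]; split.
  + by rewrite -map_comp; apply: eq_map => j /=; have [] := wP j.
  + move=> j; rewrite mem_iota => /= jK; rewrite word_ofE //.
    by have [] := wP j.
  rewrite ltNge; apply/negP => xle.
  have := @tandem_count_le_xi R (path o) h t K M n w h0 (fun j l _ => gap0 j l) late
    (fun j _ => (wP j).1) (fun j _ => (wP j).2) nt.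
  rewrite -(ler_int R) => /(le_trans xle); rewrite /x /k intrD -natr1 /=.
  have -> : (K%:Z%:~R : R) = K%:R by [].
  by lra.
move=> o Go.
have Go' j : (j <= K)%N -> c + 2 * del < rate j o <= 1 by move=> jK; exact: Go.
have xz : x + z < lam * t - 3.
  rewrite /x /z /lam mulrDl; lra.
have nt' : n%:R * h <= t.
  by apply: le_trans nt; rewrite ler_wpM2r ?(ltW h0) // ler_nat leq_addl.
have lam0 : 0 < lam by rewrite addr_gt0.
apply: le_trans (@slot_tandem_tail R h lam t x z (fun j => rate j o) n M K
   h0 h1 th lam0 nt' tn t1 z0 xz _) _.
  by move=> j jK; have /andP[rj ->] := Go' j jK; rewrite andbT; apply: lt_trans rj; rewrite /lam; lra.
rewrite /C; apply: lerD.
  apply: le_trans c2.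
  have -> : lam * t - 3 - (x + z) = del * t / 2 - k - 3 by rewrite /lam /x /z; field.
  apply: (@le_trans _ _ (t / (del * t / 4) ^+ 2)); last first.
    by rewrite le_eqVlt; apply/orP; left; apply/eqP; field; rewrite !gt_eqF.
  rewrite ler_wpM2l ?(ltW t0) //.
  have g1 : 0 < del * t / 4 by rewrite divr_gt0.
  have g2 : del * t / 4 <= del * t / 2 - k - 3 by lra.
  rewrite lef_pV2 ?posrE ?exprn_gt0 //; last exact: lt_le_trans g2.
  by rewrite lerXn2r ?nnegrE ?(ltW g1) // (le_trans (ltW g1)).
rewrite mulr_suml big_allpairs_dep big_seq [leRHS]big_seq; apply: ler_sum => j.
rewrite mem_iota => /= jK; have /andP[rj rj1] := Go' j jK.
have X2 : 2 * del < rate j o - c by lra.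
have X0 : 0 < rate j o - c by lra.
have XL : rate j o - c <= 2 ^+ L.+1 * del by lra.
apply: (@le_trans _ _ (4 / z * (rate j o - c)^-1)).
  have -> : 2 / (rate j o - lam) / z = 4 / z * (2 * (rate j o - lam))^-1.
    by field; rewrite (gt_eqF z0) /= gt_eqF // /lam; lra.
  apply: ler_wpM2l; first by rewrite divr_ge0 // ltW.
  by rewrite lef_pV2 ?posrE // /lam; lra.
have := dyadic_bound d0 X2 XL => H.
apply: (le_trans (ler_wpM2l (divr_ge0 (ler0n R 4) (ltW z0)) H)).
rewrite mulr_sumr -(big_mkord xpredT (fun l => 4 / z * ((2 ^+ l.+1 * del)^-1 *
   (rate j o - c <= 2 ^+ l.+2 * del)%R%:R))) /index_iota subn0.
apply: ler_sum => l _; rewrite /cf /= mulrA ler_wpM2l //; first exact: (cf0 (j, l)).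
rewrite indicE; case: (leP (rate j o - c) (2 ^+ l.+2 * del)) => // xl.
by rewrite mem_set //; rewrite /B /=; lra.
Qed.

End LowerTail.

Section LowerTailMain.
Context d (Omega : measurableType d) (R : realType) (P : probability Omega R).
Context (rate : nat -> {RV P >-> R}) (gap : nat -> nat -> {RV P >-> R}).
Context (clocks : poisson_clocks_given rate gap).
Context (rate_pos : forall k, P [set o | rate k o <= 0] = 0%E).
Context (rate_le1 : forall k, P [set o | 1 < rate k o] = 0%E).
Local Notation path o := (fun k l => gap k l o).

Lemma measurable_num_beyond_gap c t :
  measurable_fun setT (fun o => num_beyond (path o) c t).
Proof. by apply: (@measurable_num_beyond _ _ _ (fun k l => gap k l)). Qed.

(** Up to a null set, the particle of index [K] is beyond [c * t] outside three exceptional events: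
    a slow rate among the first [K.+1], a clock with more than [M] rings, and the lag estimated in
    [prob_lag_le]. *)
Lemma lower_tail (F : R -> R) (c q a e : R) :
  (forall k x, P [set o | rate k o <= x] = (F x)%:E) ->
  0 < c -> 0 < q -> 0 < a -> 0 < e -> (forall x, 0 < x -> F (c + x) <= q * x) ->
  exists t0 : R, forall t, t0 <= t ->
  (P [set o | num_beyond (path o) c t < (a * Num.sqrt t / ln t)%:E] <= e%:E)%E.
Proof.
move=> rate_cdf c0 q0 a0 e0 Fq.
have [t0 H] := lower_parameters q0 a0 e0; exists t0 => t /H{H} [L].
set X := a * _ / _; set K := Num.truncn X; move: K => K.
set k : R := K.+1%:R; set del := e / _ => -[[t1 XK] c1 c2 c3 [c4 c5]].
have t_gt0 : 0 < t by exact: lt_le_trans t1.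
have k0 : 0 < k by rewrite ltr0n.
have k1 : 1 <= k by rewrite ler1n.
have d0 : 0 < del by rewrite divr_gt0 ?mulr_gt0.
pose mu : R := 1 * (t + 1).
(* A clock of rate at most one then has more than [M] rings with probability at most [1 / (4 * mu)],
   which can be summed over the first [K.+1] clocks. *)
have [M M_gt] : exists M : nat, 3 * mu < M.+1%:R.
  by exists (Num.truncn (3 * mu)); exact: truncnS_gt.
have mu_gt : 1 < mu by rewrite /mu; lra.
(* With this mesh the largest lag, [K * M] slots, takes at most one unit of time. *)
pose h : R := (k * M.+1%:R)^-1.
have kM0 : 0 < k * M.+1%:R by rewrite mulr_gt0.
have h0 : 0 < h by rewrite invr_gt0.
have kMh : k * M.+1%:R * h = 1 by rewrite mulfV // gt_eqF.
have M1k : M.+1%:R <= k * M.+1%:R by rewrite ler_peMl.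
have h1 : h <= 1.
  by rewrite -kMh ler_peMl ?(ltW h0) // (le_trans _ M1k) // ler1n.
have th : t * h <= 1.
  rewrite -kMh ler_wpM2r ?(ltW h0) // (le_trans _ M1k) //.
  by rewrite /mu in M_gt; lra.
have KMh : (K * M)%:R * h <= 1.
  by rewrite -[leRHS]kMh ler_wpM2r ?(ltW h0) // natrM ler_pM // ler_nat.
have [Z Zle Zgt] : exists2 Z : nat, Z%:R * h <= t & t < Z.+1%:R * h.
  exists (Num.truncn (t / h)); last by rewrite -ltr_pdivrMr // truncnS_gt.
  by rewrite -ler_pdivlMr // truncn_le divr_ge0 // ltW.
have KMZ : (K * M <= Z)%N.
  rewrite -ltnS -(ltr_nat R) -(ltr_pM2r h0); apply: le_lt_trans Zgt.
  exact: le_trans t1.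
pose n := (Z - K * M)%N.
have nE : n%:R = Z%:R - (K * M)%:R :> R by rewrite natrB.
have nt : (K * M + n)%:R * h <= t by rewrite subnKC.
(* Of the loss [2], at most one unit is the lag and at most one the incomplete last slot. *)
have tn : t - 2 <= n%:R * h.
  by rewrite nE mulrBl; rewrite -natr1 mulrDl mul1r in Zgt; lra.
pose G := [set o | forall i, (i < K.+1)%N -> c + 2 * del < rate i o <= 1].
pose lag := [set o | ((xi (path o) K t)%:~R <= c * t)%R] `&`
      (all_positive gap `&` no_early_ring gap K M t).
pose slow i := [set o | (rate i o <= c + 2 * del)%R].
pose early i := [set o | (0 < rate i o <= 1)%R] `&`
   ([set o | (ring_time (path o) i M <= t)%R] `&` all_positive gap).
have mslow i : measurable (slow i) by exact: measurable_le_set.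
have mearly i : measurable (early i).
  apply: measurableI; first by apply: (@sigma_of_measurable _ _ _ _ rate); exact: sigma_of_rate_itv.
  by apply: measurableI; [exact: measurable_ring_time_le|exact: measurable_all_positive].
have mG : measurable G.
  apply: (@sigma_of_measurable _ _ _ _ rate).
  by apply: (@sigma_of_all _ _ _ _ _ K.+1 (fun i => [set o | c + 2 * del < rate i o <= 1])) => i; exact: sigma_of_rate_itv.
have mlag : measurable lag.
  apply: measurableI; last first.
    by apply: measurableI; [exact: measurable_all_positive|exact: measurable_no_early_ring].
  exact: measurable_xi_le.
have mU1 : measurable (\big[setU/set0]_(i < K.+1) slow i) by exact: bigsetU_measurable.
have mU2 : measurable (\big[setU/set0]_(i < K.+1) early i) by exact: bigsetU_measurable.
have mGl : measurable (G `&` lag) by exact: measurableI.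
have mU12 : measurable (\big[setU/set0]_(i < K.+1) slow i `|` \big[setU/set0]_(i < K.+1) early i).
  exact: measurableU.
apply: (@le_trans _ _ (P ((G `&` lag) `|` (\big[setU/set0]_(i < K.+1) slow i `|`
   \big[setU/set0]_(i < K.+1) early i)))).
  apply: (le_prob_modulo _ _ (measurable_regular rate gap)
    (prob_not_regular clocks rate_pos rate_le1)).
  - have := emeasurable_fun_infty_o measurableT (measurable_num_beyond_gap c t) X%:E.
    by rewrite setTI.
  - exact: measurableU.
  move=> o [/= nbX [gap0 unb r01]].
  have [[i iK sl]|noslow] := pselect (exists2 i, (i < K.+1)%N & slow i o).
    by right; left; rewrite -(bigcup_mkord K.+1 slow); exists i.
  have [[i iK sl]|noearly] := pselect (exists2 i, (i < K.+1)%N & early i o).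
    by right; right; rewrite -(bigcup_mkord K.+1 early); exists i.
  left; split.
    move=> i iK; have /andP[_ ->] := r01 i; rewrite andbT ltNge; apply/negP => sl.
    by apply: noslow; exists i.
  split.
    rewrite /= leNgt; apply/negP => ctx.
    have := num_beyond_ge XK ctx; rewrite leNgt => /negP; exact.
  split; first exact: gap0.
  move=> i iK; rewrite ltNge; apply/negP => early_i; apply: noearly; exists i => //.
  by split; [exact: r01|split].
apply: (le_trans (measureU2 P mGl mU12)).
apply: (@le_trans _ _ ((e / 8 + e / 8)%:E + ((e / 8)%:E + (e / 8)%:E))%E); last first.
  by rewrite -!EFinD lee_fin; lra.
apply: leeD; first exact: (@prob_lag_le _ _ _ _ _ _ clocks F c q e t h n M K L).
apply: (le_trans (measureU2 P mU1 mU2)); apply: leeD.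
  apply: (le_trans (prob_bigsetU_le (x := q * (2 * del)) K.+1 mslow _)).
    by move=> i; rewrite rate_cdf lee_fin Fq // mulr_gt0.
  rewrite lee_fin le_eqVlt; apply/orP; left; apply/eqP.
  by rewrite /del -/k; field; rewrite !gt_eqF.
apply: (le_trans (prob_bigsetU_le (x := (4 * (t + 1))^-1) K.+1 mearly _)); last by rewrite lee_fin.
move=> i; have mu_lt : 1 * (t + 1) < M.+1%:R by rewrite -/mu; lra.
apply: (le_trans (prob_ring_time_le clocks (@sigma_of_rate_itv _ _ _ _ rate i 0 1) _ (ltW t_gt0) mu_lt)) => //.
apply: (@le_trans _ _ ((4 * (t + 1))^-1%:E * 1)%E); last by rewrite mule1.
apply: lee_pmul => //.
- by rewrite lee_fin divr_ge0 ?sqr_ge0 // -/mu; lra.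
- rewrite lee_fin -/mu.
  have g : 0 < 2 * mu by lra.
  apply: (@le_trans _ _ (mu / (2 * mu) ^+ 2)).
    rewrite ler_wpM2l //; first by lra.
    rewrite lef_pV2 ?posrE ?exprn_gt0 //; last by lra.
    by rewrite lerXn2r ?nnegrE ?(ltW g) //; lra.
  have -> : mu / (2 * mu) ^+ 2 = (4 * mu)^-1.
    by field; rewrite gt_eqF //; lra.
  by rewrite /mu mul1r.
exact: probability_le1 (sigma_of_measurable (@sigma_of_rate_itv _ _ _ _ rate i 0 1)).
Qed.

End LowerTailMain.

(** * Combination of the two tails *)

Theorem theorem3 (R : realType)
  (c : R) (c_gt0 : 0 < c)
  (F : cumulativeBounded (0 : R) (1 : R))
  (F_below : forall p : R, p < c -> F p = 0)
  (F_c : F c = 0)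
  (F_above : forall p : R, c < p -> 0 < F p)
  (F_1 : F 1 = 1)
  (d : measure_display) (Omega : measurableType d) (P : probability Omega R)
  (rate : nat -> {RV P >-> R})
  (rate_iid : iid_with_cdf rate F)
  (gap : nat -> nat -> {RV P >-> R})
  (clocks : poisson_clocks_given rate gap)
  (kappa : R) (kappa_gt0 : 0 < kappa)
  (F_slope : F p / (p - c) @[p --> c^'+] --> kappa)
  (eps : R) (eps_gt0 : 0 < eps)
  (a : R) (a_gt0 : 0 < a) :
  exists b0 : R, forall b : R, b0 <= b ->
  exists t0 : R, forall t : R, t0 <= t ->
    ((1 - eps)%:E <=
     P [set w : Omega |
         ((a * Num.sqrt t / ln t)%:E <=
            num_beyond (fun k n => gap k n w) c t <=
          (b * Num.sqrt t)%:E)%E])%E.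
Proof.
have rate_cdf := prob_rate_le rate_iid.
have rate_pos k : P [set o | rate k o <= 0] = 0%E by rewrite rate_cdf F_below.
have rate_le1 k : P [set o | 1 < rate k o] = 0%E.
  rewrite (_ : mkset _ = ~` [set o | rate k o <= 1]); last first.
    by apply/seteqP; split=> o /=; rewrite ltNge => /negP.
  by rewrite probability_setC ?rate_cdf ?F_1 ?subee //; exact: measurable_le_set.
have c_le1 : c <= 1.
  by rewrite leNgt; apply/negP => /F_below; rewrite F_1 => /eqP; rewrite oner_eq0.
have F_le1 x : F x <= 1.
  by rewrite -lee_fin -(rate_cdf 0%N); apply: probability_le1; exact: measurable_le_set.
have [x0 x0_gt0 slope] := slope_bounds kappa_gt0 F_slope.
(* Beyond [x0] the bound [F <= 1] is absorbed by [1 <= x0^-1 * x], so the linear bound holds for all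
   [x > 0]. *)
pose q := 2 * kappa + x0^-1.
have q_gt0 : 0 < q by rewrite addr_gt0 ?mulr_gt0 ?invr_gt0.
have Fq x : 0 < x -> F (c + x) <= q * x.
  move=> x_gt0; have kx : 0 < 2 * kappa * x by rewrite !mulr_gt0.
  have x0x : 0 < x0^-1 * x by rewrite mulr_gt0 ?invr_gt0.
  have [xx0|x0x'] := ltP x x0.
    by have /andP[_] := slope x x_gt0 xx0; rewrite /q mulrDl; lra.
  have : 1 <= x0^-1 * x by rewrite mulrC ler_pdivlMr // mul1r.
  by have := F_le1 (c + x); rewrite /q mulrDl; lra.
have e2 : 0 < eps / 2 by rewrite divr_gt0.
have slope_low : exists2 y : R, 0 < y & forall x, 0 < x -> x < y -> kappa / 2 * x <= F (c + x).
  by exists x0 => // x x_gt0 xx0; have /andP[] := slope x x_gt0 xx0.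
have [b0 upper] := upper_tail clocks rate_iid rate_pos rate_le1 c_gt0 c_le1 kappa_gt0 e2 slope_low.
have [t1 lower] := lower_tail clocks rate_pos rate_le1 rate_cdf c_gt0 q_gt0 a_gt0 e2 Fq.
exists b0 => b /upper[t2 upper_t]; exists (Num.max t1 t2) => t.
rewrite ge_max => /andP[/lower lower_t /upper_t{}upper_t].
set E := [set o | _].
have mnb := measurable_num_beyond_gap gap c t.
have mlo : measurable [set o | (num_beyond (fun k l => gap k l o) c t < (a * Num.sqrt t / ln t)%:E)%E].
  by have := emeasurable_fun_infty_o measurableT mnb (a * Num.sqrt t / ln t)%:E; rewrite setTI.
have mhi : measurable [set o | ((b * Num.sqrt t)%:E < num_beyond (fun k l => gap k l o) c t)%E].
  by have := emeasurable_fun_o_infty measurableT mnb (b * Num.sqrt t)%:E; rewrite setTI.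
set lo := [set o | _] in mlo lower_t; set hi := [set o | _] in mhi upper_t.
have -> : E = ~` (lo `|` hi).
  apply/seteqP; split=> o /=.
    by move=> /andP[h1 h2] [|]; rewrite /lo /hi /= ltNge ?h1 ?h2.
  by move=> /not_orP[/negP h1 /negP h2]; rewrite /E /= !leNgt h1 h2.
rewrite probability_setC; last exact: measurableU.
rewrite EFinB; apply: leeB => //.
apply: (le_trans (measureU2 P mlo mhi)).
apply: (@le_trans _ _ ((eps / 2)%:E + (eps / 2)%:E)%E); first exact: leeD.
by rewrite -EFinD -splitr.
Qed.
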